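(* Let $n\ge 3$, $\rho_1>0$, $\lambda>0$, $\beta>0$ and $\alpha=2\beta+\rho_1$. Let $\overline{m}_0\in\left(0,\frac{n-2}{n}\right)$ satisfy $\beta\ge\beta_0^{(\overline{m}_0)}$, where $\beta_0^{(m)}:=\frac{m\rho_1}{n-2-nm}$. For any $0<m<\overline{m}_0$, let $\alpha_m=\frac{2\beta+\rho_1}{1-m}$ and let $v^{(m)}$ be the unique radially symmetric solution of $$\Delta(v^m/m)+\alpha_m v+\beta x\cdot\nabla v=0,\quad v>0,\quad\text{in }\mathbb{R}^n\setminus\{0\}$$ which satisfies $$\lim_{|x|\to 0}|x|^{\alpha_m/\beta}v(x)=\lambda^{-\frac{\rho_1}{(1-m)\beta}}.$$ Then as $m\to0^+$, $v^{(m)}$ converges uniformly in $C^2(K)$, for any compact subset $K$ of $\mathbb{R}^n\setminus\{0\}$, to the unique radially symmetric solution $v$ of $$\Delta\log v+\alpha v+\beta x\cdot\nabla v=0,\quad v>0,\quad\text{in }\mathbb{R}^n\setminus\{0\}$$ which satisfies $$\lim_{|x|\to0}|x|^{\alpha/\beta}v(x)=\lambda^{-\frac{\rho_1}{\beta}}.$$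
   Context: A solution of either elliptic equation in $\mathbb{R}^n\setminus\{0\}$ is a positive function $v\in C^2(\mathbb{R}^n\setminus\{0\})$ satisfying the equation in the classical sense. The existence of $v^{(m)}$ for $0<m<\frac{n-2}{n}$ and $\beta\ge\beta_0^{(m)}$ is a known result (K. M. Hui); its uniqueness holds when $\beta>\beta_0^{(m)}$. Since $m\mapsto\beta_0^{(m)}$ is increasing, $\beta>\beta_0^{(m)}$ for all $0<m<\overline{m}_0$. *)

(* Defs.v *)
From HB Require Import structures.
From mathcomp Require Import all_boot all_order all_algebra.
From mathcomp Require Import all_classical all_reals all_analysis.

Set Implicit Arguments.
Unset Strict Implicit.
Unset Printing Implicit Defensive.

Import Order.TTheory GRing.Theory Num.Theory.
Import numFieldNormedType.Exports.

Local Open Scope classical_set_scope.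
Local Open Scope ring_scope.

Section Defs.
Variables (R : realType) (n : nat).
Implicit Types (f v : 'rV[R]_n -> R) (x y : 'rV[R]_n) (K : set 'rV[R]_n).

(* The library norm on 'rV[R]_n is the sup norm (same topology); radial
   symmetry and |x| below refer to the Euclidean norm. *)
Definition enorm x : R := Num.sqrt (\sum_(i < n) x 0 i ^+ 2).

Definition partial (i : 'I_n) f : 'rV[R]_n -> R := 'D_(delta_mx 0 i) f.

Definition laplacian f x : R := \sum_(i < n) partial i (partial i f) x.

Definition x_dot_grad f x : R := \sum_(i < n) x 0 i * partial i f x.

(* Functions on R^n \ {0} are represented by total functions whose value at 0
   is irrelevant. *)
Definition C2_off0 f : Prop := forall x, x != 0 ->
  {for x, continuous f} /\
  forall i, [/\ derivable f x (delta_mx 0 i),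
    {for x, continuous (partial i f)} &
    forall j, derivable (partial i f) x (delta_mx 0 j) /\
      {for x, continuous (partial j (partial i f))}].

Definition radially_symmetric f : Prop :=
  forall x y, x != 0 -> y != 0 -> enorm x = enorm y -> f x = f y.

Definition elliptic_solution (phi : R -> R) (a b : R) v : Prop :=
  [/\ C2_off0 v,
      forall x, x != 0 -> 0 < v x &
      forall x, x != 0 ->
        laplacian (phi \o v) x + a * v x + b * x_dot_grad v x = 0].

Definition radial_solution_with_limit (phi : R -> R) (a b c : R) v : Prop :=
  [/\ elliptic_solution phi a b v,
      radially_symmetric v &
      enorm x `^ (a / b) * v x @[x --> (0 : 'rV[R]_n)^'] --> c].

(* Uniqueness is equality on R^n \ {0}. *)
Definition unique_radial_solution_with_limit
    (phi : R -> R) (a b c : R) v : Prop :=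
  radial_solution_with_limit phi a b c v /\
  forall w, radial_solution_with_limit phi a b c w ->
    forall x, x != 0 -> w x = v x.

Definition cvg_uniform_C2 K (F : set_system R)
    (vm : R -> 'rV[R]_n -> R) v : Prop :=
  [/\ {uniform K, vm @ F --> v},
      forall i, {uniform K, (fun m => partial i (vm m)) @ F --> partial i v} &
      forall i j, {uniform K, (fun m => partial j (partial i (vm m))) @ F -->
                              partial j (partial i v)}].

Definition beta0 (rho1 m : R) : R := m * rho1 / (n%:R - 2 - n%:R * m).

Definition alpha_ (rho1 beta m : R) : R := (2 * beta + rho1) / (1 - m).

End Defs.

(* Main.v *)
Require Import Defs.
From HB Require Import structures.
From mathcomp Require Import all_boot all_order all_algebra.
From mathcomp Require Import all_classical all_reals all_analysis.
From mathcomp Require Import ring lra.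
Import Order.TTheory GRing.Theory Num.Theory.
Import numFieldNormedType.Exports.
Local Open Scope classical_set_scope.
Local Open Scope ring_scope.

(** Both equations are turned into one first-order system in the logarithmic
    radius [s = ln |x|].  Put [N = n - 2], [k = rho1 / beta], [G = 2 + k] and
    [mu = m / (1 - m)].  For a radial solution [v] of exponent [m], where
    [m = 0] stands for the logarithmic equation, the function
    [y = (1 - m) ln v + G s] satisfies

      y' = q,
      q' = (G - q) (N - mu (G - q)) - beta e^(y - k s) q,
      y -> l := - k ln lambda   as s -> -oo.

    The dependence on [m] is carried by the single parameter [mu], and the
    behaviour required of [v] at the origin becomes the same condition at -oo
    for every [m].

    A priori bounds.  Since [y] converges at -oo, its slope [q] cannot stay
    above a positive level on a left half-line; hence [q s < c] as soon as
    [q' < 0] wherever [q] meets the level [c] to the left of [s] (lemma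
    [trap]).  With suitable levels this gives [0 <= q < G] and
    [q <= B e^(k s)], hence [l <= y <= l + (B / k) e^(k s)], for all small
    [mu].  In particular the absorption term [beta e^(y - k s) q] is bounded
    on every half-line [s <= S], although its coefficient blows up at -oo.

    Stability.  The same trap, applied to the difference of two profiles with
    parameters [mu1] and [mu2], bounds their distance on [s <= S] by a constant
    times [|mu1 - mu2|] (lemma [stability]).  For [mu1 = mu2 = 0] this is the
    uniqueness of the logarithmic solution.  For [mu1, mu2 -> 0] it says that
    the given solutions form a Cauchy family, so that no existence theory is
    needed for the limit equation: the limit of the family solves the system
    with [mu = 0] (lemma [profile_limit]) and hence defines the logarithmic
    solution (lemma [log_solution]).

    Convergence.  The value, the gradient and the Hessian of a radial solution
    are explicit continuous expressions in [m], [y], [q] and [x], because the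
    system expresses [q'] through [y] and [q].  They therefore converge jointly
    as [m -> 0+] and [x' -> x], for every [x <> 0]; on a compact set this is
    uniform convergence. *)

Set Implicit Arguments.
Unset Strict Implicit.
Unset Printing Implicit Defensive.

(** * Calculus on the real line *)

Section Calculus.
Variable R : realType.
Implicit Types (f df g : R -> R) (a b c s t l : R).

Lemma is_derive_continuous f df : (forall t, is_derive t 1 f (df t)) ->
  continuous f.
Proof.
move=> fd t; apply: differentiable_continuous; apply/derivable1_diffP.
by have := fd t; case.
Qed.

Lemma mean_value f df a b : (forall t, is_derive t 1 f (df t)) -> a <= b ->
  exists2 c, a <= c <= b & f b - f a = df c * (b - a).
Proof.
move=> fd; rewrite le_eqVlt => /predU1P[<-|ab].
  by exists a; rewrite ?lexx// !subrr mulr0.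
have [|c] := @MVT R f df a b ab (fun x _ => fd x).
  by apply: continuous_subspaceT; exact: is_derive_continuous fd.
by rewrite in_itv/= => /andP[ac cb] e; exists c; rewrite ?(ltW ac) ?(ltW cb).
Qed.

Lemma ge0_derive_le f df a b : (forall t, is_derive t 1 f (df t)) -> a <= b ->
  (forall t, a < t < b -> 0 <= df t) -> f a <= f b.
Proof.
move=> fd; rewrite le_eqVlt => /predU1P[<-//|ab] df0.
have [|c] := @MVT R f df a b ab (fun x _ => fd x).
  by apply: continuous_subspaceT; exact: is_derive_continuous fd.
rewrite in_itv/= => cab e; rewrite -subr_ge0 e mulr_ge0 ?df0//.
by rewrite subr_ge0 ltW.
Qed.

(** The first time at which a continuous function reaches a level. *)
Lemma first_time f c t s : continuous f -> t <= s -> f t < c -> c <= f s ->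
  exists u, [/\ t < u, u <= s, f u = c & forall w, t <= w < u -> f w < c].
Proof.
move=> fc ts ftc cfs.
pose A := [set u | [/\ t <= u, u <= s & c <= f u]].
have As : A s by split.
have hA : has_inf A by split; [exists s|exists t => u []].
have lA u : A u -> inf A <= u by move=> ?; apply: ge_inf => //; exact: hA.2.
have tA : t <= inf A by apply: lb_le_inf; [exact: hA.1|move=> u []].
have As' : inf A <= s by exact: lA.
have below w : t <= w < inf A -> f w < c.
  move=> /andP[tw wA]; rewrite ltNge; apply/negP => cfw.
  by have := lA w; rewrite leNgt wA => /(_ _)/negP; apply => //; split=> //;
     exact: le_trans (ltW wA) As'.
have fA : c <= f (inf A).
  rewrite leNgt; apply/negP => fAc.
  have /nbhs_ballP[e /= e0 he] : \forall u \near inf A, f u < c.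
    exact: (cvgr_lt (f (inf A)) (fc (inf A))).
  have [u Au ue] := inf_adherent e0 hA.
  have := Au; case=> _ _; rewrite leNgt => /negP; apply; apply: he.
  rewrite /ball/= ltr_norml; have := lA u Au; lra.
have tA' : t < inf A.
  rewrite lt_neqAle tA andbT; apply: contraTneq fA => <-.
  by rewrite -ltNge.
exists (inf A); split => //.
apply/eqP; rewrite eq_le fA andbT leNgt; apply/negP => cfA.
have /nbhs_ballP[e /= e0 he] : \forall u \near inf A, c < f u.
  exact: (cvgr_gt (f (inf A)) (fc (inf A))).
pose w := Num.max t (inf A - e / 2).
have /andP[w1 w2] : t <= w < inf A.
  by rewrite le_max lexx/= gt_max tA'/= ltrBlDr ltrDl divr_gt0.
have := below w; rewrite w1 w2 => /(_ isT); apply/negP; rewrite -leNgt ltW//.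
apply: he; rewrite /ball/= ltr_norml.
have : inf A - e / 2 <= w by rewrite le_max lexx orbT.
by lra.
Qed.

Lemma derive_ge0_left f d s t : is_derive s 1 f d -> t < s ->
  (forall w, t <= w < s -> f w <= f s) -> 0 <= d.
Proof.
move=> [fd <-] ts hf; rewrite leNgt; apply/negP => d0.
have /nbhs_ballP[e /= e0 he] : \forall w \near (0 : R),
    w != 0 -> w^-1 *: ((f \o shift s) (w *: 1) - f s) < 0.
  exact: (cvgr_lt _ fd _ d0).
pose h := - Num.min (e / 2) (s - t).
have h0 : h < 0 by rewrite oppr_lt0 lt_min divr_gt0//= subr_gt0.
have he2 : - h <= e / 2 by rewrite opprK ge_min lexx.
have hst : - h <= s - t by rewrite opprK ge_min lexx orbT.
have := he h; rewrite /ball/= sub0r normrN ltr0_norm//.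
have -> : - h < e by lra.
have -> : h != 0 by rewrite lt_eqF.
move=> /(_ isT isT).
rewrite scaler1 /GRing.scale/= nmulr_rlt0 ?invr_lt0// subr_gt0.
by apply/negP; rewrite -leNgt; apply: hf; lra.
Qed.

(** A level that [f] can only cross downwards: if [f] is above it at [s], it
    has been above it at all earlier times. *)
Lemma level_trap f df c s : (forall t, is_derive t 1 f (df t)) ->
  (forall t, t <= s -> f t = c -> df t < 0) -> c <= f s ->
  forall t, t <= s -> c <= f t.
Proof.
move=> fd hc cs t ts; rewrite leNgt; apply/negP => ftc.
have [u [tu us fuc fw]] :=
  first_time (is_derive_continuous fd) ts ftc cs.
have := hc u us fuc; apply/negP; rewrite -leNgt.
by apply: (derive_ge0_left (fd u) tu) => w /fw; rewrite fuc => /ltW.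
Qed.

(** The slope [f] of a function [y] that converges at -oo stays below every
    positive level that it can only cross downwards: otherwise [f >= c] on
    the whole half-line, and [y] would tend to -oo there. *)
Lemma trap y f df c s l : 0 < c -> (forall t, is_derive t 1 y (f t)) ->
  (forall t, is_derive t 1 f (df t)) ->
  y t @[t --> -oo] --> l ->
  (forall t, t <= s -> f t = c -> df t < 0) -> f s < c.
Proof.
move=> c0 yd fd yl hc; rewrite ltNge; apply/negP => cs.
have cf := level_trap fd hc cs.
have h : \forall t \near -oo, l - 1 < y t.
  by apply: (cvgr_gt _ yl); rewrite ltrBlDr ltrDl.
have [t [h1 h2 h3]] : exists t, [/\ l - 1 < y t, t <= s &
    t <= s - (y s - l + 1) / c].
  have : \forall t \near (-oo : set_system R), [/\ l - 1 < y t, t <= s &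
      t <= s - (y s - l + 1) / c].
    near=> t; split; first by near: t.
    - by near: t; apply: nbhs_ninfty_le; exact: num_real.
    - by near: t; apply: nbhs_ninfty_le; exact: num_real.
  by move/filter_ex.
have [w /andP[tw ws] e] := mean_value yd h2.
have : c * (s - t) <= y s - y t.
  by rewrite e ler_wpM2r ?subr_ge0// cf.
have : c * ((y s - l + 1) / c) <= c * (s - t).
  by rewrite ler_pM2l//; lra.
rewrite mulrCA divff ?gt_eqF// mulr1; lra.
Unshelve. all: by end_near. Qed.

(** A function that is nondecreasing before [s] is at least its limit at -oo. *)
Lemma ge_cvgNy f df s l : (forall t, is_derive t 1 f (df t)) ->
  f t @[t --> -oo] --> l -> (forall t, t < s -> 0 <= df t) -> l <= f s.
Proof.
move=> fd fl df0; apply: (cvgr_to_le fl); near=> t.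
apply: (ge0_derive_le fd) => [|w /andP[_ ws]]; last exact: df0.
by near: t; apply: nbhs_ninfty_le; exact: num_real.
Unshelve. all: by end_near. Qed.

End Calculus.

(** * The profile equation: a priori bounds *)

Section Profile.
Variables (R : realType) (N G b k l : R).
Hypotheses (N0 : 0 < N) (G0 : 0 < G) (b0 : 0 < b) (k0 : 0 < k).
Implicit Types (mu s t eta : R) (y q : R -> R).

(** Right-hand side of the equation for the slope [p = q s] of the profile,
    with [u = y s].  The first term is called the reaction term below, the
    second one the absorption term. *)
Definition profile_rhs mu s (u p : R) : R :=
  (G - p) * (N - mu * (G - p)) - b * expR (u - k * s) * p.

(** A profile of parameter [mu]: a function [y] with slope [q] that solves the
    system on the whole line and tends to [l] at -oo. *)
Definition profile mu y q : Prop :=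
  [/\ forall s, is_derive s 1 y (q s),
      forall s, is_derive s 1 q (profile_rhs mu s (y s) (q s)) &
      y s @[s --> -oo] --> l].

(** Smallness of [mu] that keeps the reaction term nonnegative for slopes in
    [[-G, G]] and makes it nonincreasing for slopes in [[0, G]]. *)
Definition small_exponent mu : Prop := 0 <= mu /\ 2 * mu * G <= N.

(** The constant [B] of the bound [q s <= B e^(k s)]: the slope at which the
    absorption term, with [y] replaced by its lower bound [l], balances the
    largest value [G N] of the reaction term. *)
Definition slope_bound : R := G * N / (b * expR l).
Local Notation B := slope_bound.

Let bl0 : 0 < b * expR l. Proof. by rewrite mulr_gt0 ?expR_gt0. Qed.

Lemma slope_bound_gt0 : 0 < B.
Proof. by rewrite /slope_bound divr_gt0 ?mulr_gt0 ?expR_gt0. Qed.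

Lemma is_derive_expRk s :
  is_derive s 1 (fun t => expR (k * t)) (k * expR (k * s)).
Proof.
have h : is_derive s 1 (fun t => k * t) k.
  have h := @is_deriveZ _ _ _ _ k _ _ _ (is_derive_id s (1 : R)).
  by apply: (is_derive_eq h); rewrite /GRing.scale/= mulr1.
have h' := @is_derive1_comp _ expR _ s _ _ (is_derive_expR _) h.
by apply: (is_derive_eq h'); exact: mulrC.
Qed.

Lemma cvgNy_expRk : expR (k * t) @[t --> -oo] --> (0 : R).
Proof.
apply/cvgr0Pnorm_lt => e e0.
near=> t; rewrite ger0_norm ?expR_ge0//.
rewrite -[ltRHS]lnK ?posrE// ltr_expR mulrC -ltr_pdivlMr//.
by near: t; apply: nbhs_ninfty_lt; exact: num_real.
Unshelve. all: by end_near. Qed.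

Section Bounds.
Variables (mu : R) (y q : R -> R).
Hypotheses (hmu : small_exponent mu) (hp : profile mu y q).

Lemma profile_slope_lt s : q s < G.
Proof.
case: hp => yd qd yl.
apply: (trap G0 yd qd yl) => t _ qt.
rewrite /profile_rhs qt subrr mul0r sub0r oppr_lt0.
by rewrite !mulr_gt0 ?expR_gt0.
Qed.

Lemma profile_slope_ge0 s : 0 <= q s.
Proof.
case: hp => yd qd yl; case: hmu => mu0 mu1.
rewrite leNgt; apply/negP => qs.
(* The level must be at most [G] for the reaction term to be nonnegative. *)
pose c := Num.min G (- q s).
have c0 : 0 < c by rewrite lt_min G0 oppr_gt0.
have cG : c <= G by rewrite ge_min lexx.
have : - q s < c.
  have yd' t : is_derive t 1 (- y) (- q t) by exact: is_deriveN.
  have qd' t : is_derive t 1 (fun t => - q t) (- profile_rhs mu t (y t) (q t)).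
    by exact: is_deriveN.
  apply: (trap c0 yd' qd' (cvgN yl)) => t _ /eqP; rewrite eqr_oppLR => /eqP qt.
  rewrite /profile_rhs qt opprK oppr_lt0 mulrN opprK.
  have p1 : 0 < b * expR (y t - k * t) * c by rewrite !mulr_gt0 ?expR_gt0.
  suff : 0 <= (G + c) * (N - mu * (G + c)) by lra.
  apply: mulr_ge0; first lra.
  nra.
by rewrite ltNge => /negP; apply; rewrite ge_min lexx orbT.
Qed.

Lemma profile_ge s : l <= y s.
Proof.
by case: hp => yd _ yl; apply: (ge_cvgNy yd yl) => t _; exact: profile_slope_ge0.
Qed.

Lemma reaction_bounds s :
  0 <= (G - q s) * (N - mu * (G - q s)) <= G * N.
Proof.
have := profile_slope_ge0 s; have := profile_slope_lt s.
case: hmu => mu0 mu1 h1 h2.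
have h5 : 0 <= G - q s by lra.
have h3 : 0 <= mu * (G - q s) by rewrite mulr_ge0.
have h4 : mu * (G - q s) <= N by nra.
by apply/andP; split; [apply: mulr_ge0; lra|apply: ler_pM; lra].
Qed.

Lemma absorption_ge s c : 0 <= c ->
  b * expR l * c <= expR (k * s) * (b * expR (y s - k * s) * c).
Proof.
move=> c0; rewrite expRB.
rewrite [leRHS](_ : _ = b * expR (y s) * c); last first.
  by field; rewrite gt_eqF ?expR_gt0.
by rewrite ler_wpM2r// ler_pM2l// ler_expR profile_ge.
Qed.

Lemma profile_slope_le s : q s <= B * expR (k * s).
Proof.
case: (hp) => yd qd yl.
rewrite leNgt; apply/negP => hs.
have c0 : 0 < q s.
  by rewrite (lt_trans _ hs)// mulr_gt0 ?slope_bound_gt0 ?expR_gt0.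
suff : q s < q s by rewrite ltxx.
apply: (trap c0 yd qd yl) => t ts qt.
rewrite /profile_rhs.
have /andP[_ h1] := reaction_bounds t.
have h2 := absorption_ge t (ltW c0).
rewrite -qt in hs h2 *.
suff : G * N < b * expR (y t - k * t) * q t by lra.
have et := expR_gt0 (k * t).
rewrite -(ltr_pM2l et); apply: lt_le_trans h2.
have h3 : expR (k * t) <= expR (k * s) by rewrite ler_expR ler_pM2l.
have h4 : B * expR (k * t) < q t.
  by apply: le_lt_trans hs; rewrite ler_pM2l ?slope_bound_gt0.
have -> : expR (k * t) * (G * N) = b * expR l * (B * expR (k * t)).
  by rewrite /slope_bound; field; rewrite !gt_eqF ?expR_gt0.
by rewrite ltr_pM2l.
Qed.

Lemma profile_le s : y s <= l + B / k * expR (k * s).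
Proof.
case: (hp) => yd qd yl.
pose g t := B / k * expR (k * t) - y t.
have gd t : is_derive t 1 g (B * expR (k * t) - q t).
  apply: is_deriveB; have h := is_derive_expRk t.
  apply: (is_derive_eq (is_deriveZ (B / k) h)).
  by rewrite /GRing.scale/=; field; rewrite gt_eqF.
have gl : g t @[t --> -oo] --> - l.
  rewrite -[- l]add0r -[X in X - l](mulr0 (B / k)).
  by apply: cvgB => //; apply: cvgM; [exact: cvg_cst|exact: cvgNy_expRk].
have : - l <= g s.
  by apply: (ge_cvgNy gd gl) => t _; rewrite subr_ge0 profile_slope_le.
by rewrite /g; lra.
Qed.

Lemma absorption_le s : b * expR (y s - k * s) * q s <= b * B * expR (y s).
Proof.
rewrite expRB.
have -> : b * (expR (y s) / expR (k * s)) * q s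
    = b * expR (y s) * (q s / expR (k * s)) by ring.
rewrite mulrAC ler_wpM2r ?expR_ge0// ler_pM2l//.
by rewrite ler_pdivrMr ?expR_gt0// profile_slope_le.
Qed.

Lemma profile_rhs_le s :
  `|profile_rhs mu s (y s) (q s)| <= G * N + b * B * expR (y s).
Proof.
have /andP[h1 h2] := reaction_bounds s; have h3 := absorption_le s.
have h4 : 0 <= b * expR (y s - k * s) * q s.
  by rewrite !mulr_ge0 ?expR_ge0 ?profile_slope_ge0// ltW.
have h5 : 0 <= G * N by rewrite mulr_ge0 ?ltW.
by rewrite /profile_rhs ler_norml; apply/andP; split; lra.
Qed.

End Bounds.

Lemma expR_lipschitz (x z M : R) : x <= M -> z <= M ->
  `|expR x - expR z| <= expR M * `|x - z|.
Proof.
have h (u v : R) : u <= M -> expR u - expR v <= expR M * `|u - v|.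
  move=> uM; have h1 : expR u - expR v <= expR u * (u - v).
    have := expR_ge1Dx (v - u); rewrite expRB => h1.
    have e0 := expR_gt0 u.
    have : expR u * (1 + (v - u)) <= expR u * (expR v / expR u).
      by rewrite ler_pM2l.
    by rewrite mulrCA divff ?gt_eqF// mulr1; lra.
  apply: (le_trans h1); apply: (le_trans (ler_wpM2l _ (ler_norm _))).
    exact: expR_ge0.
  by rewrite ler_wpM2r// ler_expR.
move=> xM zM; rewrite ler_norml; apply/andP; split; last exact: h.
by have := h z x zM; rewrite distrC; lra.
Qed.

(** Upper bound of all profiles of small parameter on the half-line
    [s <= S]. *)
Definition profile_ceiling S : R := l + B / k * expR (k * S).

Lemma profile_le_ceiling mu y q S s : small_exponent mu -> profile mu y q ->
  s <= S -> y s <= profile_ceiling S.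
Proof.
move=> hmu hp sS; apply: (le_trans (profile_le hmu hp s)).
by rewrite lerD2l ler_wpM2l ?ler_expR ?ler_pM2l// divr_ge0 ?ltW ?slope_bound_gt0.
Qed.

(** * Stability of profiles with respect to the parameter *)

Section Stability.
Variables (S : R).

(* [K] is a Lipschitz constant of the absorption term with respect to [y],
   along profiles on the half-line [s <= S]. *)
Let K : R := b * B * expR (profile_ceiling S).
Let C : R := 2 * K / (b * expR l * k).

Let K0 : 0 < K.
Proof. exact: (mulr_gt0 (mulr_gt0 b0 slope_bound_gt0) (expR_gt0 _)). Qed.
Let C0 : 0 < C.
Proof. by rewrite /C divr_gt0// mulr_gt0. Qed.

(* The barrier for [|y1 - y2|]; its derivative [H'] is the barrier for
   [|q1 - q2|].  The constant [C] is chosen so that the absorption rate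
   [b e^(l - k t)] times [H' t] equals [2 K H t], which dominates the source
   terms of the equation for [q1 - q2]. *)
Let H (eta t : R) : R := eta * expR (C * expR (k * t)).
Let H' (eta t : R) : R := C * k * expR (k * t) * H eta t.

Let H_gt0 eta t : 0 < eta -> 0 < H eta t.
Proof. by move=> e0; rewrite /H mulr_gt0 ?expR_gt0. Qed.

Let H_le eta t s : 0 < eta -> t <= s -> H eta t <= H eta s.
Proof.
by move=> e0 ts; rewrite /H ler_pM2l// ler_expR ler_pM2l// ler_expR ler_pM2l.
Qed.

Let H'_le eta t s : 0 < eta -> t <= s -> H' eta t <= H' eta s.
Proof.
move=> e0 ts; apply: ler_pM; last exact: H_le.
- by apply: mulr_ge0; [apply: mulr_ge0; exact: ltW|exact: expR_ge0].
- by apply: ltW; exact: H_gt0.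
- by rewrite (ler_pM2l (mulr_gt0 C0 k0)) ler_expR ler_pM2l.
Qed.

Let H_derive eta t : is_derive t 1 (H eta) (H' eta t).
Proof.
have h := is_deriveZ C (is_derive_expRk t).
have h1 := @is_derive1_comp _ expR _ t _ _ (is_derive_expR _) h.
apply: (is_derive_eq (is_deriveZ eta h1)).
by rewrite /H' /H /GRing.scale/=; ring.
Qed.

(* A bound on [|y1 - y2|] up to time [s] controls the difference of slopes. *)
Let stability_slope mu1 y1 q1 mu2 y2 q2 eta s :
  small_exponent mu1 -> small_exponent mu2 ->
  profile mu1 y1 q1 -> profile mu2 y2 q2 ->
  0 < eta -> `|mu1 - mu2| * G ^+ 2 <= K * eta -> s <= S ->
  (forall t, t <= s -> `|y1 t - y2 t| <= H eta t) -> q1 s - q2 s <= H' eta s.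
Proof.
move=> hmu1 hmu2 hp1 hp2 eta0 dmu sS hH.
case: (hp1) => yd1 qd1 yl1; case: (hp2) => yd2 qd2 yl2.
rewrite leNgt; apply/negP; set c := q1 s - q2 s => Hc.
have c0 : 0 < c.
  apply: lt_trans Hc; apply: mulr_gt0; last exact: H_gt0.
  by apply: mulr_gt0 (expR_gt0 _); exact: mulr_gt0.
suff : c < c by rewrite ltxx.
have yd t : is_derive t 1 (fun t => y1 t - y2 t) (q1 t - q2 t).
  exact: is_deriveB.
have qd t : is_derive t 1 (fun t => q1 t - q2 t)
    (profile_rhs mu1 t (y1 t) (q1 t) - profile_rhs mu2 t (y2 t) (q2 t)).
  exact: is_deriveB.
apply: (trap c0 yd qd (cvgB yl1 yl2)) => t ts qt.
set e := expR (y1 t - k * t).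
have -> : profile_rhs mu1 t (y1 t) (q1 t) - profile_rhs mu2 t (y2 t) (q2 t) =
   - (c * (N - mu1 * ((G - q1 t) + (G - q2 t)))) + (mu2 - mu1) * (G - q2 t) ^+ 2
   - b * e * c - b * (e - expR (y2 t - k * t)) * q2 t.
  by rewrite /profile_rhs -/e -qt; ring.
have q1G := profile_slope_lt hp1 t; have q2G := profile_slope_lt hp2 t.
have q10 := profile_slope_ge0 hmu1 hp1 t.
have q20 := profile_slope_ge0 hmu2 hp2 t.
have T1 : 0 <= c * (N - mu1 * ((G - q1 t) + (G - q2 t))).
  by case: hmu1 => m0 m1; apply: mulr_ge0; [lra|nra].
have T2 : (mu2 - mu1) * (G - q2 t) ^+ 2 <= K * H eta t.
  apply: (@le_trans _ _ (`|mu1 - mu2| * G ^+ 2)).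
    rewrite distrC; apply: (le_trans (ler_wpM2r _ (ler_norm _))).
      exact: sqr_ge0.
    by rewrite ler_wpM2l// ler_pXn2r ?nnegrE//; lra.
  apply: (le_trans dmu); rewrite ler_pM2l// /H ler_peMr ?ltW//.
  by rewrite pexpR_gt1// mulr_gt0 ?expR_gt0.
have T4 : - (b * (e - expR (y2 t - k * t)) * q2 t) <= K * H eta t.
  apply: (@le_trans _ _ (K * `|y1 t - y2 t|)); last first.
    by rewrite ler_pM2l// hH.
  rewrite /e !expRB.
  have -> : - (b * (expR (y1 t) / expR (k * t) -
      expR (y2 t) / expR (k * t)) * q2 t) =
    b * (q2 t / expR (k * t)) * (expR (y2 t) - expR (y1 t)) by ring.
  rewrite /K -[leRHS]mulrA.
  have h1 : 0 <= b * (q2 t / expR (k * t)).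
    by rewrite mulr_ge0 ?(ltW b0)// divr_ge0 ?expR_ge0.
  apply: (le_trans (ler_wpM2l h1 (ler_norm _))).
  have tS := le_trans ts sS.
  apply: ler_pM => //.
    rewrite ler_pM2l// ler_pdivrMr ?expR_gt0//.
    exact: (profile_slope_le hmu2 hp2 t).
  rewrite distrC; apply: expR_lipschitz.
    exact: (profile_le_ceiling hmu1 hp1 tS).
  exact: (profile_le_ceiling hmu2 hp2 tS).
suff T3 : 2 * K * H eta t < b * e * c by lra.
have h2 := absorption_ge hmu1 hp1 t (ltW c0); rewrite -/e in h2.
have et := expR_gt0 (k * t).
rewrite -(ltr_pM2l et); apply: lt_le_trans h2.
have Hct := le_lt_trans (H'_le eta0 ts) Hc.
have -> : expR (k * t) * (2 * K * H eta t) = b * expR l * H' eta t.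
  by rewrite /H' /C; field; rewrite !gt_eqF ?expR_gt0.
by rewrite ltr_pM2l.
Qed.

Let H_cvg eta : H eta t @[t --> -oo] --> eta.
Proof.
rewrite -[X in _ --> X]mulr1 -(expR0 R) -(mulr0 C).
apply: cvgM; first exact: cvg_cst.
apply: (@continuous_cvg _ _ _ _ _ (fun t => C * expR (k * t)) expR (C * 0)).
  exact: continuous_expR.
by apply: cvgM; [exact: cvg_cst|exact: cvgNy_expRk].
Qed.

(* Both barriers hold: at a first time [u] where [|y1 - y2|] meets [H], the
   slope bound before [u] makes [H - (y1 - y2)] and [H + (y1 - y2)] nondecreasing
   up to [u], while both tend to [eta > 0] at -oo. *)
Let stability_bounds mu1 y1 q1 mu2 y2 q2 eta :
  small_exponent mu1 -> small_exponent mu2 ->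
  profile mu1 y1 q1 -> profile mu2 y2 q2 ->
  0 < eta -> `|mu1 - mu2| * G ^+ 2 <= K * eta ->
  forall s, s <= S -> `|y1 s - y2 s| <= H eta s /\ `|q1 s - q2 s| <= H' eta s.
Proof.
move=> hmu1 hmu2 hp1 hp2 eta0 dmu.
have slope s : s <= S -> (forall t, t <= s -> `|y1 t - y2 t| <= H eta t) ->
    `|q1 s - q2 s| <= H' eta s.
  move=> sS hs; rewrite ler_norml; apply/andP; split; last first.
    exact: (stability_slope hmu1 hmu2 hp1 hp2 eta0 dmu sS hs).
  rewrite lerNl opprB; apply: (stability_slope hmu2 hmu1 hp2 hp1 eta0 _ sS).
    by rewrite distrC.
  by move=> t /hs; rewrite distrC.
suff lt_H s : s <= S -> `|y1 s - y2 s| < H eta s.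
  move=> s sS; split; first by rewrite ltW ?lt_H.
  by apply: slope => // t ts; rewrite ltW ?lt_H ?(le_trans ts).
move=> sS; rewrite ltNge; apply/negP => Hs.
case: (hp1) => yd1 qd1 yl1; case: (hp2) => yd2 qd2 yl2.
have yd t : is_derive t 1 (fun t => y1 t - y2 t) (q1 t - q2 t).
  exact: is_deriveB.
have yl : y1 t - y2 t @[t --> -oo] --> (0 : R).
  by rewrite -[X in _ --> X](subrr l); exact: cvgB.
have [T [_ hT]] : \forall t \near (-oo : set_system R), `|y1 t - y2 t| < eta.
  by move/cvgr0Pnorm_lt : yl; exact.
have near_lt t : t < T -> `|y1 t - y2 t| < H eta t.
  move=> /hT h; apply: lt_trans h _; rewrite /H ltr_pMr//.
  by rewrite pexpR_gt1// mulr_gt0 ?expR_gt0.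
pose f (t : R) : R := `|y1 t - y2 t| - H eta t.
have fc : continuous f.
  move=> t; apply: cvgB; last exact: (is_derive_continuous (H_derive eta)).
  by apply: cvg_norm; exact: (is_derive_continuous yd).
pose t := Num.min s (T - 1).
have tT : t < T by rewrite gt_min; apply/orP; right; lra.
have [u [tu us fu fw]] : exists u, [/\ t < u, u <= s, f u = 0 &
    forall w, t <= w < u -> f w < 0].
  apply: (first_time fc); first by rewrite ge_min lexx.
    by rewrite subr_lt0 near_lt.
  by rewrite subr_ge0.
have below w : w < u -> `|y1 w - y2 w| < H eta w.
  move=> wu; have [wt|tw] := ltP w t; first by apply: near_lt; lra.
  by rewrite -subr_lt0; apply: fw; rewrite tw.
have slope_u w : w < u -> `|q1 w - q2 w| <= H' eta w.
  move=> wu; apply: slope => [|v vw]; first lra.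
  by rewrite ltW// below//; lra.
have Hc := @H_cvg eta.
have m1 : eta <= H eta u - (y1 u - y2 u).
  have gd (v : R) : is_derive v 1 (fun v => H eta v - (y1 v - y2 v))
     (H' eta v - (q1 v - q2 v)) by apply: is_deriveB (H_derive eta v) (yd v).
  have gl : H eta v - (y1 v - y2 v) @[v --> -oo] --> eta.
    by rewrite -[X in _ --> X]subr0; exact: cvgB.
  apply: (ge_cvgNy gd gl) => v /slope_u; rewrite ler_norml subr_ge0.
  by move=> /andP[].
have m2 : eta <= H eta u + (y1 u - y2 u).
  have gd (v : R) : is_derive v 1 (fun v => H eta v + (y1 v - y2 v))
     (H' eta v + (q1 v - q2 v)) by apply: is_deriveD (H_derive eta v) (yd v).
  have gl : H eta v + (y1 v - y2 v) @[v --> -oo] --> eta.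
    by rewrite -[X in _ --> X]addr0; exact: cvgD.
  apply: (ge_cvgNy gd gl) => v /slope_u; rewrite ler_norml => /andP[h _].
  by rewrite -lerBlDl sub0r.
have : `|y1 u - y2 u| < H eta u.
  by rewrite ltr_norml; apply/andP; split; lra.
by move: fu; rewrite /f; lra.
Qed.

(** On a half-line [s <= S], two profiles and their slopes differ by at most a
    constant times the difference of their parameters. *)
Lemma stability : exists2 M : R, 0 < M &
  forall mu1 y1 q1 mu2 y2 q2 eta,
  small_exponent mu1 -> small_exponent mu2 ->
  profile mu1 y1 q1 -> profile mu2 y2 q2 ->
  0 < eta -> `|mu1 - mu2| <= eta ->
  forall s, s <= S -> `|y1 s - y2 s| <= M * eta /\ `|q1 s - q2 s| <= M * eta.
Proof.
pose A := G ^+ 2 / K.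
have A0 : 0 < A by rewrite /A divr_gt0// exprn_gt0.
pose E := A * expR (C * expR (k * S)).
have E0 : 0 < E by rewrite mulr_gt0 ?expR_gt0.
have F0 : 0 < C * k * expR (k * S).
  by apply: mulr_gt0 (expR_gt0 _); exact: mulr_gt0.
have EF0 := mulr_gt0 F0 E0.
exists (E + C * k * expR (k * S) * E); first lra.
move=> mu1 y1 q1 mu2 y2 q2 eta hmu1 hmu2 hp1 hp2 eta0 dmu s sS.
have Aeta0 : 0 < A * eta by rewrite mulr_gt0.
have [|h1 h2] := stability_bounds hmu1 hmu2 hp1 hp2 Aeta0 _ sS.
  rewrite /A; have -> : K * (G ^+ 2 / K * eta) = eta * G ^+ 2.
    by field; rewrite gt_eqF.
  by rewrite ler_wpM2r// sqr_ge0.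
have HE : H (A * eta) S = E * eta by rewrite /H /E; ring.
split.
- apply: (le_trans h1); apply: (le_trans (H_le Aeta0 sS)); rewrite HE.
  by rewrite ler_wpM2r ?ltW//; lra.
- apply: (le_trans h2); apply: (le_trans (H'_le Aeta0 sS)).
  rewrite /H' HE mulrA ler_wpM2r ?(ltW eta0)//; lra.
Qed.

(** The Lipschitz constant of the slope does not depend on the parameter: the
    growth of [e^(- k s)] at -oo is compensated by [q s <= B e^(k s)]. *)
Lemma slope_lipschitz : exists2 M : R, 0 < M &
  forall mu y q, small_exponent mu -> profile mu y q ->
  forall s t, s <= S -> t <= S -> `|q s - q t| <= M * `|s - t|.
Proof.
have GN0 := mulr_gt0 G0 N0.
exists (G * N + K); first by move: K0; lra.
move=> mu y q hmu hp.
have h s t : s <= t -> t <= S -> `|q t - q s| <= (G * N + K) * `|t - s|.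
  move=> st tS; case: (hp) => _ qd _.
  have [c /andP[_ ct] ->] := mean_value qd st.
  rewrite normrM ler_wpM2r//; apply: (le_trans (profile_rhs_le hmu hp c)).
  rewrite lerD2l (ler_pM2l (mulr_gt0 b0 slope_bound_gt0)) ler_expR.
  exact: (profile_le_ceiling hmu hp (le_trans ct tS)).
move=> s t sS tS; have [st|/ltW ts] := leP s t; last exact: h.
by rewrite distrC [leRHS](_ : _ = (G * N + K) * `|t - s|) ?h// distrC.
Qed.

End Stability.

End Profile.

(** * Joint limits of families of functions *)

Section JointLimits.
Variables (R : realType) (I : Type) (F : set_system I).
Context {PF : ProperFilter F}.

(** For an equi-Lipschitz family, convergence at the point [s] is joint
    convergence in the index and the point. *)
Lemma joint_cvg (f : I -> R -> R) (M s l : R) :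
  (\forall i \near F & t \near s, `|f i t - f i s| <= M * `|t - s|) ->
  f i s @[i --> F] --> l ->
  f p.1 p.2 @[p --> filter_prod F (nbhs s)] --> l.
Proof.
move=> fM fl; apply/cvgrPdist_lt => e e0.
have h1 : \forall p \near filter_prod F (nbhs s), `|l - f p.1 s| < e / 2.
  apply: (@filter_prod1 _ _ F (nbhs s) _ (fun i => `|l - f i s| < e / 2)).
  by move/cvgrPdist_lt : fl; apply; rewrite divr_gt0.
pose M' := `|M| + 1.
have M'0 : 0 < M' by rewrite ltr_pwDr.
have h2 : \forall p \near filter_prod F (nbhs s), `|p.2 - s| < e / 2 / M'.
  apply: (@filter_prod2 _ _ F (nbhs s) _ (fun t => `|t - s| < e / 2 / M')).
  near=> t; rewrite distrC; near: t; apply: cvgr_dist_lt => //.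
  by rewrite !divr_gt0.
near=> p.
have h3 : `|f p.1 p.2 - f p.1 s| <= M * `|p.2 - s| by near: p.
have h4 : `|p.2 - s| < e / 2 / M' by near: p.
have h5 : `|l - f p.1 s| < e / 2 by near: p.
have h6 : M * `|p.2 - s| < e / 2.
  move: h4; rewrite ltr_pdivlMr// mulrC; apply: le_lt_trans.
  by rewrite ler_wpM2r// /M'; have := ler_norm M; lra.
have := ler_distD (f p.1 s) l (f p.1 p.2); rewrite (distrC (f p.1 s)); lra.
Unshelve. all: by end_near. Qed.

(** If a family converges pointwise and its derivatives converge jointly in the
    index and the point, the limit is differentiable there. *)
Lemma derive_joint_limit (f df : I -> R -> R) (f0 : R -> R) (s d : R) :
  (\forall i \near F, forall t : R, is_derive t 1 (f i) (df i t)) ->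
  (forall t, f i t @[i --> F] --> f0 t) ->
  df p.1 p.2 @[p --> filter_prod F (nbhs s)] --> d ->
  is_derive s 1 f0 d.
Proof.
move=> fd fl dfl.
have key : h^-1 *: ((f0 \o shift s) (h *: 1) - f0 s) @[h --> 0^'] --> d.
  apply/cvgrPdist_le => e e0.
  have /cvgrPdist_le/(_ e e0)[[A B] /= [FA /nbhs_ballP[r /= r0 rB]] AB] := dfl.
  have : \forall h \near (0 : R), `|h| < r.
    by near=> h; rewrite -[h]subr0 distrC; near: h; exact: cvgr_dist_lt.
  move=> hr; near=> h.
  have h0 : h != 0 by near: h; exact: nbhs_dnbhs_neq.
  have hlt : `|h| < r by near: h; exact: (nbhs_dnbhs hr).
  rewrite /= [h *: 1]mulr1 /GRing.scale/=.
  suff H : `|f0 (h + s) - f0 s - d * h| <= e * `|h|.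
    have hn : 0 < `|h| by rewrite normr_gt0.
    rewrite distrC -(ler_pM2r hn) -normrM.
    suff -> : (h^-1 * (f0 (h + s) - f0 s) - d) * h =
      f0 (h + s) - f0 s - d * h by [].
    by field.
  have lim : `|f i (h + s) - f i s - d * h| @[i --> F]
      --> `|f0 (h + s) - f0 s - d * h|.
    apply: cvg_norm; apply: cvgB; last exact: cvg_cst.
    by apply: cvgB; exact: fl.
  apply: (cvgr_to_le lim); near=> i.
  have Ai : A i by near: i.
  have fdi : forall t : R, is_derive t 1 (f i) (df i t) by near: i.
  have [c cr ->] : exists2 c, `|c - s| < r & f i (h + s) - f i s = df i c * h.
    have n1 := ler_norm h; have n2 := ler_norm (- h); rewrite normrN in n2.
    have [h_ge|h_lt] := leP 0 h.
      have sh : s <= h + s by lra.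
      have [c /andP[sc ch] e1] := mean_value fdi sh.
      exists c; first by rewrite ger0_norm; lra.
      by rewrite e1; congr (_ * _); ring.
    have hs : h + s <= s by lra.
    have [c /andP[sc ch] e1] := mean_value fdi hs.
    exists c; first by rewrite ler0_norm; lra.
    by rewrite -opprB e1; ring.
  rewrite -mulrBl normrM ler_wpM2r// distrC.
  by apply: (AB (i, c)); split => //=; apply: rB; rewrite /ball/= distrC.
by apply: DeriveDef; [apply/cvg_ex; exists d|exact: cvg_lim key].
Unshelve. all: by end_near. Qed.

End JointLimits.

(** * Profiles of vanishing parameter *)

Section FamilyLimit.
Variables (R : realType) (N G b k l : R).
Hypotheses (N0 : 0 < N) (G0 : 0 < G) (b0 : 0 < b) (k0 : 0 < k).
Local Notation profile := (profile N G b k l).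
Local Notation small_exponent := (small_exponent N G).

Lemma profile_unique y1 q1 y2 q2 : profile 0 y1 q1 -> profile 0 y2 q2 ->
  forall s, y1 s = y2 s.
Proof.
move=> hp1 hp2 s.
have sm : small_exponent 0 by split=> //; rewrite mulr0 mul0r ltW.
have [M M0 hM] := stability l N0 G0 b0 k0 s.
apply/eqP; rewrite -subr_eq0 -normr_eq0 eq_le normr_ge0 andbT.
apply/ler_addgt0Pr => e e0; rewrite add0r.
have eta0 : 0 < e / M by rewrite divr_gt0.
have := hM 0 y1 q1 0 y2 q2 (e / M) sm sm hp1 hp2 eta0.
rewrite subrr normr0 => /(_ (ltW eta0) s (lexx s))[+ _].
by rewrite mulrCA divff ?gt_eqF// mulr1.
Qed.

Variables (I : Type) (F : set_system I).
Context {PF : ProperFilter F}.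
Variables (mu : I -> R) (y q : I -> R -> R).
Hypotheses (mu_lim : mu i @[i --> F] --> (0 : R))
  (mu_small : \forall i \near F, small_exponent (mu i))
  (yq_profile : \forall i \near F, profile (mu i) (y i) (q i)).

Let cauchy_profiles (f : I -> R) :
  (exists2 M, 0 < M & forall i j eta, small_exponent (mu i) ->
    small_exponent (mu j) -> profile (mu i) (y i) (q i) ->
    profile (mu j) (y j) (q j) -> 0 < eta -> `|mu i - mu j| <= eta ->
    `|f i - f j| <= M * eta) -> cvg (f i @[i --> F]).
Proof.
case=> M M0 hM; apply/cauchy_cvgP/cauchy_exP => e e0.
pose eta := e / 2 / M.
have eta0 : 0 < eta by rewrite !divr_gt0.
have near_mu : \forall i \near F, `|mu i| < eta / 2.
  by move/cvgr0Pnorm_lt : mu_lim; apply; rewrite divr_gt0.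
have [i [i1 i2 i3]] : exists i, [/\ small_exponent (mu i),
    profile (mu i) (y i) (q i) & `|mu i| < eta / 2].
  apply: (@filter_ex _ F); near=> i.
  by split; near: i.
exists (f i); rewrite nbhs_simpl/=; near=> j; rewrite /ball/=.
have j1 : small_exponent (mu j) by near: j.
have j2 : profile (mu j) (y j) (q j) by near: j.
have j3 : `|mu j| < eta / 2 by near: j.
have := hM i j eta i1 j1 i2 j2 eta0.
have -> : `|mu i - mu j| <= eta by have := ler_normB (mu i) (mu j); lra.
move=> /(_ isT); rewrite /eta mulrCA divff ?gt_eqF// mulr1; lra.
Unshelve. all: by end_near. Qed.

(** Profiles whose parameters tend to [0] converge, together with their slopes
    and jointly in the index and the point, to a profile of parameter [0]. *)
Lemma profile_limit : exists y0 q0, [/\ profile 0 y0 q0,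
  forall s, y p.1 p.2 @[p --> filter_prod F (nbhs s)] --> y0 s &
  forall s, q p.1 p.2 @[p --> filter_prod F (nbhs s)] --> q0 s].
Proof.
have y_cvg s : cvg (y i s @[i --> F]).
  apply: cauchy_profiles => //.
  have [M M0 hM] := stability l N0 G0 b0 k0 s.
  exists M => // i j eta i1 j1 i2 j2 e0 e1.
  by have [] := hM _ _ _ _ _ _ _ i1 j1 i2 j2 e0 e1 s (lexx s).
have q_cvg s : cvg (q i s @[i --> F]).
  apply: cauchy_profiles => //.
  have [M M0 hM] := stability l N0 G0 b0 k0 s.
  exists M => // i j eta i1 j1 i2 j2 e0 e1.
  by have [] := hM _ _ _ _ _ _ _ i1 j1 i2 j2 e0 e1 s (lexx s).
pose y0 s := lim (y i s @[i --> F]); pose q0 s := lim (q i s @[i --> F]).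
have y_joint s : y p.1 p.2 @[p --> filter_prod F (nbhs s)] --> y0 s.
  apply: (@joint_cvg _ _ _ _ _ G); last exact: y_cvg.
  near=> i t.
  have sm : small_exponent (mu i) by near: i.
  have hp : profile (mu i) (y i) (q i) by near: i.
  case: (hp) => yd _ _.
  have h u v : u <= v -> `|y i v - y i u| <= G * `|v - u|.
    move=> uv; have [c _ ->] := mean_value yd uv.
    rewrite normrM ler_wpM2r// ger0_norm ?(profile_slope_ge0 G0 b0 sm hp)//.
    exact: ltW (profile_slope_lt G0 b0 hp c).
  have [ts|/ltW st] := leP t s; last exact: h.
  by rewrite distrC [leRHS](_ : _ = G * `|s - t|) ?h// distrC.
have q_joint s : q p.1 p.2 @[p --> filter_prod F (nbhs s)] --> q0 s.
  have [M M0 hM] := slope_lipschitz l N0 G0 b0 k0 (s + 1).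
  apply: (@joint_cvg _ _ _ _ _ M); last exact: q_cvg.
  have near_s : \forall t \near s, t <= s + 1.
    near=> t; apply: ltW; near: t; apply: lt_nbhsl; rewrite ltrDl.
    exact: ltr01.
  have sm_near := @filter_prod1 _ _ F (nbhs s) _ _ mu_small.
  have hp_near := @filter_prod1 _ _ F (nbhs s) _ _ yq_profile.
  have s_near := @filter_prod2 _ _ F (nbhs s) _ _ near_s.
  near=> p => /=.
  have sm : small_exponent (mu p.1) by near: p; exact: sm_near.
  have hp : profile (mu p.1) (y p.1) (q p.1) by near: p; exact: hp_near.
  by apply: (hM _ _ _ sm hp); [near: p; exact: s_near|rewrite lerDl].
exists y0, q0; split => //; split.
- move=> s; apply: (@derive_joint_limit _ _ F _ y q) => //.
  by near=> i; have [] : profile (mu i) (y i) (q i) by near: i.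
- move=> s; apply: (@derive_joint_limit _ _ F _ q
      (fun i t => profile_rhs N G b k (mu i) t (y i t) (q i t))) => //.
    by near=> i; have [] : profile (mu i) (y i) (q i) by near: i.
  have h1 : G - q p.1 p.2 @[p --> filter_prod F (nbhs s)] --> G - q0 s.
    by apply: cvgB => //; exact: cvg_cst.
  have h2 : mu p.1 @[p --> filter_prod F (nbhs s)] --> (0 : R).
    by apply: cvg_comp mu_lim; exact: cvg_fst.
  have h3 : y p.1 p.2 - k * p.2 @[p --> filter_prod F (nbhs s)] --> y0 s - k * s.
    apply: cvgB => //; apply: cvgM; first exact: cvg_cst.
    exact: cvg_snd.
  apply: cvgB.
    apply: cvgM => //; apply: cvgB; first exact: cvg_cst.
    exact: cvgM.
  apply: cvgM => //; apply: cvgM; first exact: cvg_cst.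
  by apply: continuous_cvg => //; exact: continuous_expR.
- have h1 : l + slope_bound N G b l / k * expR (k * s) @[s --> -oo] --> l.
    rewrite -[X in _ --> X]addr0 -(mulr0 (slope_bound N G b l / k)).
    apply: cvgD; first exact: cvg_cst.
    by apply: cvgM; [exact: cvg_cst|exact: cvgNy_expRk].
  have h2 : (fun=> l) s @[s --> (-oo : set_system R)] --> l by exact: cvg_cst.
  apply: (squeeze_cvgr _ h2 h1).
  near=> s; apply/andP; split.
    apply: (cvgr_to_ge (y_cvg s)); near=> i.
    have sm : small_exponent (mu i) by near: i.
    have hp : profile (mu i) (y i) (q i) by near: i.
    exact: (profile_ge G0 b0 sm hp s).
  apply: (cvgr_to_le (y_cvg s)); near=> i.
  have sm : small_exponent (mu i) by near: i.
  have hp : profile (mu i) (y i) (q i) by near: i.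
  exact: (profile_le N0 G0 b0 k0 sm hp s).
Unshelve. all: by end_near. Qed.

End FamilyLimit.

(** * Derivatives of radial functions *)

Section RadialCalculus.
Variables (R : realType) (n : nat).
Implicit Types (x v : 'rV[R]_n) (i j : 'I_n) (s : R).
Local Notation e_ i := (delta_mx 0 i : 'rV[R]_n).

Lemma is_derive_line (W : normedModType R) (f : W -> R) (x v : W) (d : R) :
  is_derive x v f d <-> is_derive (0 : R) 1 (fun h : R => f (h *: v + x)) d.
Proof.
have E : 'D_v f x = 'D_1 (fun h : R => f (h *: v + x)) 0.
  rewrite /derive; set g1 := fun h => h^-1 *: _; set g2 := fun h => h^-1 *: _.
  suff -> : g1 = g2 by [].
  by rewrite funeqE /g1 /g2 => h /=; rewrite addr0 scale0r add0r [_%:A]mulr1.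
split=> -[h <-]; apply: DeriveDef.
- exact: (iffLR (derivable1P f x v) h).
- by rewrite E.
- exact: (iffRL (derivable1P f x v) h).
- exact: E.
Qed.

Lemma is_derive_chain (W : normedModType R) (G : R -> R) (g : W -> R)
    (x v : W) (a b : R) :
  is_derive (g x) 1 G a -> is_derive x v g b ->
  is_derive x v (fun z => G (g z)) (a * b).
Proof.
move=> hG /is_derive_line hg; apply/is_derive_line.
apply: (@is_derive1_comp _ G (fun h => g (h *: v + x))).
by rewrite scale0r add0r.
Qed.

Lemma is_derive_coord x v i : is_derive x v (fun z : 'rV[R]_n => z 0 i) (v 0 i).
Proof.
apply/is_derive_line.
have -> : (fun h : R => (h *: v + x) 0 i) = (fun h => v 0 i * h + x 0 i).
  by apply/funext => h; rewrite !mxE mulrC.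
have h := is_deriveD (is_deriveZ (v 0 i) (is_derive_id (0 : R) 1))
  (is_derive_cst (x 0 i) (0 : R) 1).
by apply: (is_derive_eq h); rewrite /GRing.scale/= mulr1 addr0.
Qed.

(** Squared Euclidean norm. *)
Definition sqnorm x : R := \sum_(i < n) x 0 i ^+ 2.

(** Logarithm of the Euclidean norm, the variable in which radial functions are
    written; its value at the origin is irrelevant. *)
Definition lognorm x : R := ln (enorm x).

Lemma sqnorm_ge0 x : 0 <= sqnorm x.
Proof. by apply: sumr_ge0 => i _; exact: sqr_ge0. Qed.

Lemma sqnorm_gt0 x : x != 0 -> 0 < sqnorm x.
Proof.
move=> x0; rewrite lt_neqAle sqnorm_ge0 andbT eq_sym; apply: contra x0.
rewrite psumr_eq0 => [/allP h|i _]; last exact: sqr_ge0.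
apply/eqP/rowP => i; rewrite mxE; apply/eqP; rewrite -sqrf_eq0.
by apply: h; rewrite mem_index_enum.
Qed.

Lemma enorm_gt0 x : x != 0 -> 0 < enorm x.
Proof. by move=> x0; rewrite sqrtr_gt0 sqnorm_gt0. Qed.

Lemma expR_lognorm x : x != 0 -> expR (lognorm x) = enorm x.
Proof. by move=> x0; rewrite /lognorm lnK// posrE enorm_gt0. Qed.

Lemma lognormE x : x != 0 -> lognorm x = ln (sqnorm x) / 2.
Proof.
move=> x0; rewrite /lognorm /enorm -powR12_sqrt ?sqnorm_ge0//.
by rewrite ln_powR mulrC.
Qed.

Lemma expR_2lognorm x : x != 0 -> expR (2 * lognorm x) = sqnorm x.
Proof.
move=> x0; rewrite lognormE// mulrCA divff ?mulr1 ?lnK// posrE.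
exact: sqnorm_gt0.
Qed.

Lemma is_derive_sqnorm x i : is_derive x (e_ i) sqnorm (2 * x 0 i).
Proof.
have h j : is_derive x (e_ i) ((fun z : 'rV[R]_n => z 0 j) ^+ 2)
    (2 * x 0 j * (j == i)%:R).
  apply: (is_derive_eq (is_deriveX 2 (is_derive_coord x (e_ i) j))).
  by rewrite /GRing.scale/= expr1 mxE eqxx.
have -> : sqnorm = \sum_(j < n) ((fun z : 'rV[R]_n => z 0 j) ^+ 2).
  by apply/funext => z; rewrite fct_sumE.
apply: (is_derive_eq (is_derive_sum h)).
rewrite (bigD1 i)//= eqxx mulr1 big1 ?addr0// => j /negPf ->.
by rewrite mulr0.
Qed.

Lemma near_neq0 x : x != 0 -> \forall z \near x, z != 0.
Proof.
move=> x0; apply: (@open_nbhs_nbhs _ x [set z | z != 0]); split=> //.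
have -> : [set z : 'rV[R]_n | z != 0] = ~` [set 0].
  by apply/seteqP; split => z /= /eqP.
apply: closed_openC; apply: accessible_closed_set1.
by apply: hausdorff_accessible; exact: norm_hausdorff.
Qed.

Lemma is_derive_lognorm x i : x != 0 ->
  is_derive x (e_ i) lognorm (x 0 i / sqnorm x).
Proof.
move=> x0; have r0 := sqnorm_gt0 x0.
apply: (@near_eq_is_derive _ _ _ (fun z => 2^-1 * ln (sqnorm z))).
  near=> z; rewrite lognormE 1?mulrC//.
  by near: z; exact: near_neq0.
have h := is_derive_chain (is_derive1_ln r0) (is_derive_sqnorm x i).
apply: (is_derive_eq (is_deriveZ 2^-1 h)).
by rewrite /GRing.scale/=; field; rewrite gt_eqF.
Unshelve. all: by end_near. Qed.

(* A function [v] that equals [V (ln |x|)] off the origin. *)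
Section RadialFunction.
Variables (v : 'rV[R]_n -> R) (V V1 V2 : R -> R).
Hypotheses (vE : forall x, x != 0 -> v x = V (lognorm x))
  (dV : forall s, is_derive s 1 V (V1 s))
  (dV1 : forall s, is_derive s 1 V1 (V2 s)).

Lemma is_derive_radial x i : x != 0 ->
  is_derive x (e_ i) v (V1 (lognorm x) * (x 0 i / sqnorm x)).
Proof.
move=> x0; apply: (@near_eq_is_derive _ _ _ (fun z => V (lognorm z))).
  near=> z; rewrite vE//.
  by near: z; exact: near_neq0.
exact: is_derive_chain (is_derive_lognorm i x0).
Unshelve. all: by end_near. Qed.

Lemma partial_radial x i : x != 0 ->
  partial i v x = V1 (lognorm x) * (x 0 i / sqnorm x).
Proof. by move=> x0; have [] := is_derive_radial i x0. Qed.

(** Entry [(i, j)] of the Hessian of [V (ln |x|)]. *)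
Definition radial_hessian x i j : R :=
  V2 (lognorm x) * (x 0 i * x 0 j / sqnorm x ^+ 2) +
  V1 (lognorm x) * ((i == j)%:R / sqnorm x - 2 * (x 0 i * x 0 j) / sqnorm x ^+ 2).

Lemma is_derive_partial_radial x i j : x != 0 ->
  is_derive x (e_ j) (partial i v) (radial_hessian x i j).
Proof.
move=> x0; have r0 := sqnorm_gt0 x0.
have rn : sqnorm x != 0 by rewrite gt_eqF.
pose g (z : 'rV[R]_n) := V1 (lognorm z) * (z 0 i * (sqnorm z)^-1).
apply: (@near_eq_is_derive _ _ _ g).
  near=> z; rewrite partial_radial//.
  by near: z; exact: near_neq0.
have h1 := is_derive_chain (dV1 (lognorm x)) (is_derive_lognorm j x0).
have h2 := is_derive_chain (is_deriveV rn (is_derive_id (sqnorm x) 1))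
  (is_derive_sqnorm x j).
have h3 := is_deriveM h1 (is_deriveM (is_derive_coord x (e_ j) i) h2).
apply: (is_derive_eq h3).
rewrite /radial_hessian /GRing.scale/= mxE eqxx/=.
rewrite -[X in _ + X * _ = _]/(x 0 i * (sqnorm x)^-1).
by field.
Unshelve. all: by end_near. Qed.

Lemma partial2_radial x i j : x != 0 ->
  partial j (partial i v) x = radial_hessian x i j.
Proof. by move=> x0; have [] := is_derive_partial_radial i j x0. Qed.

Lemma laplacian_radial x : x != 0 -> laplacian v x =
  (V2 (lognorm x) + (n%:R - 2) * V1 (lognorm x)) / sqnorm x.
Proof.
move=> x0; have r0 := sqnorm_gt0 x0.
have rn : sqnorm x != 0 by rewrite gt_eqF.
rewrite /laplacian.
under eq_bigr => i _ do rewrite partial2_radial// /radial_hessian eqxx.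
have -> : \sum_(i < n) (V2 (lognorm x) * (x 0 i * x 0 i / sqnorm x ^+ 2) +
   V1 (lognorm x) * (1%:R / sqnorm x - 2 * (x 0 i * x 0 i) / sqnorm x ^+ 2)) =
  \sum_(i < n) ((V2 (lognorm x) - 2 * V1 (lognorm x)) / sqnorm x ^+ 2 * x 0 i ^+ 2
    + V1 (lognorm x) / sqnorm x).
  by apply: eq_bigr => i _; field.
rewrite big_split/= -mulr_sumr -/(sqnorm x) sumr_const card_ord -mulr_natl.
by field.
Qed.

Lemma x_dot_grad_radial x : x != 0 -> x_dot_grad v x = V1 (lognorm x).
Proof.
move=> x0; have rn : sqnorm x != 0 by rewrite gt_eqF// sqnorm_gt0.
rewrite /x_dot_grad.
under eq_bigr => i _ do rewrite partial_radial//.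
have -> : \sum_(i < n) x 0 i * (V1 (lognorm x) * (x 0 i / sqnorm x)) =
  \sum_(i < n) V1 (lognorm x) / sqnorm x * x 0 i ^+ 2.
  by apply: eq_bigr => i _; field.
by rewrite -mulr_sumr -/(sqnorm x) divfK.
Qed.

End RadialFunction.

End RadialCalculus.

(** * From radial solutions to profiles *)

Section SolutionToProfile.
Variables (R : realType) (n : nat) (n_gt0 : (0 < n)%N).
Implicit Types (x : 'rV[R]_n) (s : R) (v : 'rV[R]_n -> R).
Let i0 : 'I_n := Ordinal n_gt0.
Let e0 : 'rV[R]_n := delta_mx 0 i0.
(* The half-line through a basis vector, parametrized by the logarithm of the
   radius. *)
Let ray s : 'rV[R]_n := expR s *: e0.

Let sqnorm_ray s : sqnorm (ray s) = expR (2 * s).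
Proof.
rewrite /sqnorm (bigD1 i0)//= big1 => [|i /negPf ii0].
  by rewrite !mxE !eqxx/= mulr1 addr0 mulrC expRM_natr.
by rewrite !mxE ii0 andbF mulr0 expr0n.
Qed.

Let ray_neq0 s : ray s != 0.
Proof.
apply: contraTneq (expR_gt0 (2 * s)) => h; rewrite -sqnorm_ray h.
by rewrite /sqnorm big1 ?ltxx// => i _; rewrite mxE expr0n.
Qed.

Let lognorm_ray s : lognorm (ray s) = s.
Proof. by rewrite lognormE ?ray_neq0// sqnorm_ray expRK mulrC mulKf. Qed.

Let derive_ray v s : derivable v (ray s) e0 ->
  is_derive s 1 (fun t => v (ray t)) (partial i0 v (ray s) * expR s).
Proof.
move=> dv.
suff h : is_derive (expR s) 1 (fun r => v (r *: e0)) (partial i0 v (ray s)).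
  exact: (is_derive_chain h (is_derive_expR s)).
apply/is_derive_line.
have -> : (fun h : R => v ((h *: 1 + expR s) *: e0)) =
    (fun h => v (h *: e0 + ray s)).
  by apply/funext => h; rewrite [h *: 1]mulr1 scalerDl.
exact: (iffLR (is_derive_line v (ray s) e0 _) (derivableP dv)).
Qed.

(** A radial [C^2] function is a twice differentiable function of [ln |x|]. *)
Lemma radial_generatrix v : C2_off0 v -> radially_symmetric v ->
  exists V V1 V2, [/\ forall x, x != 0 -> v x = V (lognorm x),
    forall s, is_derive s 1 V (V1 s) & forall s, is_derive s 1 V1 (V2 s)].
Proof.
move=> vC2 vrad.
pose V s := v (ray s).
pose V1 s := partial i0 v (ray s) * expR s.
pose V2 s := partial i0 v (ray s) *: expR s +
  expR s *: (partial i0 (partial i0 v) (ray s) * expR s).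
exists V, V1, V2; split.
- move=> x x0; apply: (vrad x (ray (lognorm x)) x0 (@ray_neq0 _)).
  rewrite -[LHS](expR_lognorm x0) -[RHS](expR_lognorm (ray_neq0 _)).
  by rewrite lognorm_ray.
- move=> s; apply: derive_ray.
  by have [_ /(_ i0)[]] := vC2 _ (ray_neq0 s).
- move=> s; apply: is_deriveM; apply: derive_ray.
  by have [_ /(_ i0)[_ _ /(_ i0)[]]] := vC2 _ (ray_neq0 s).
Qed.

Let ray_cvg : ray s @[s --> -oo] --> (0 : 'rV[R]_n)^'.
Proof.
have expR0 : expR s @[s --> -oo] --> (0 : R).
  under eq_fun do rewrite -[X in expR X]mul1r.
  by apply: cvgNy_expRk.
have h : ray s @[s --> -oo] --> (0 : 'rV[R]_n).
  rewrite -(scale0r e0); apply: cvgZ => //; exact: cvg_cst.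
move=> A /h hA.
have {}hA : \forall s \near (-oo : set_system R), ray s != 0 -> A (ray s) := hA.
suff : \forall s \near (-oo : set_system R), A (ray s) by [].
by apply: filterS hA => s; apply; exact: ray_neq0.
Qed.

(** The power and the logarithmic nonlinearities are treated at once: both
    [s ^ m / m] and, for [m = 0], [ln s] have the derivative [e^(m u)] with
    respect to [u] after the substitution [s = e^u]. *)
Lemma solution_profile phi m a b c G v : 0 <= m < 1 -> 0 < b -> 0 < c ->
  (1 - m) * a = b * G ->
  (forall u : R, is_derive u 1 (fun t => phi (expR t)) (expR (m * u))) ->
  radial_solution_with_limit phi a b c v ->
  exists y q, profile (n%:R - 2) G b (G - 2) ((1 - m) * ln c) (m / (1 - m)) y q /\
    forall x, x != 0 -> v x = expR ((y (lognorm x) - G * lognorm x) / (1 - m)).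
Proof.
move=> /andP[m0 m1] b0 c0 aG dphi [[vC2 vpos veq] vrad vlim].
have m1' : 1 - m != 0 by rewrite gt_eqF// subr_gt0.
have [V [V1 [V2 [vE dV dV1]]]] := radial_generatrix vC2 vrad.
have Vray s : v (ray s) = V s by rewrite vE ?ray_neq0// lognorm_ray.
have Vpos s : 0 < V s by rewrite -Vray vpos ?ray_neq0.
have Vn s : V s != 0 by rewrite gt_eqF.
pose psi s := ln (V s).
have Vpsi s : V s = expR (psi s) by rewrite /psi lnK ?posrE.
pose psi1 s := V1 s * (V s)^-1.
pose psi2 s := V2 s / V s - psi1 s ^+ 2.
have dpsi s : is_derive s 1 psi (psi1 s).
  apply: (is_derive_eq (is_derive_chain (is_derive1_ln (Vpos s)) (dV s))).
  by rewrite mulrC.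
have dpsi1 s : is_derive s 1 psi1 (psi2 s).
  have := is_deriveM (dV1 s) (is_deriveV (Vn s) (dV s)).
  move=> h; apply: (is_derive_eq h).
  by rewrite /psi2 /psi1 /GRing.scale/=; field.
pose Phi s := phi (expR (psi s)).
pose Phi1 s := expR (m * psi s) * psi1 s.
have dPhi s : is_derive s 1 Phi (Phi1 s).
  exact: is_derive_chain (dphi _) (dpsi s).
have dexp s : is_derive s 1 (fun t => expR (m * psi t))
    (expR (m * psi s) * (m * psi1 s)).
  by apply: is_derive_chain; exact: (is_deriveZ m (dpsi s)).
pose Phi2 s := expR (m * psi s) * (psi2 s + m * psi1 s ^+ 2).
have dPhi1 s : is_derive s 1 Phi1 (Phi2 s).
  apply: (is_derive_eq (is_deriveM (dexp s) (dpsi1 s))).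
  by rewrite /Phi2 /GRing.scale/=; ring.
have PhiE x : x != 0 -> (phi \o v) x = Phi (lognorm x).
  by move=> x0; rewrite /= vE// /Phi -Vpsi.
(* The elliptic equation at radius [e^s], written for [psi = ln V]. *)
have ode s : psi2 s = - m * psi1 s ^+ 2 - (n%:R - 2) * psi1 s
    - expR (2 * s) * expR ((1 - m) * psi s) * (a + b * psi1 s).
  have := veq _ (ray_neq0 s).
  rewrite (laplacian_radial PhiE dPhi dPhi1 (ray_neq0 s)).
  rewrite (x_dot_grad_radial vE dV (ray_neq0 s)) Vray lognorm_ray sqnorm_ray.
  have -> : V1 s = V s * psi1 s by rewrite /psi1; field.
  have -> : V s = expR (m * psi s) * expR ((1 - m) * psi s).
    by rewrite Vpsi -expRD; congr expR; ring.
  rewrite /Phi2 /Phi1 => h.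
  have en : expR (m * psi s) != 0 by rewrite gt_eqF ?expR_gt0.
  have e2 : expR (2 * s) != 0 by rewrite gt_eqF ?expR_gt0.
  apply: (mulfI en); apply: (mulIf (invr_neq0 e2)).
  apply/eqP; rewrite -subr_eq0 -h; apply/eqP; field.
  by rewrite e2.
pose y s := (1 - m) * psi s + G * s.
pose q s := (1 - m) * psi1 s + G.
exists y, q; split; last first.
  move=> x x0; rewrite vE// Vpsi /y; congr expR.
  by rewrite addrK mulrAC divff ?mul1r.
split.
- move=> s.
  have h := is_deriveD (is_deriveZ (1 - m) (dpsi s))
    (is_deriveZ G (is_derive_id s 1)).
  by apply: (is_derive_eq h); rewrite /q /GRing.scale/= mulr1.
- move=> s.
  have h := is_deriveD (is_deriveZ (1 - m) (dpsi1 s)) (is_derive_cst G s 1).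
  apply: (is_derive_eq h); rewrite /GRing.scale/= addr0 /profile_rhs /q ode.
  have -> : y s - (G - 2) * s = (1 - m) * psi s + 2 * s by rewrite /y; ring.
  have aE : a = b * G / (1 - m) by rewrite -aG mulrAC divff ?mul1r.
  by rewrite expRD aE; field.
- have h := cvg_comp _ _ ray_cvg vlim.
  have {}h : expR (a / b * s + psi s) @[s --> -oo] --> c.
    apply: cvg_trans h; apply: near_eq_cvg; near=> s => /=.
    rewrite Vray -(expR_lognorm (ray_neq0 s)) lognorm_ray -expRM expRD Vpsi.
    by rewrite [s * _]mulrC.
  have {}h : a / b * s + psi s @[s --> -oo] --> ln c.
    have h1 : ln (expR (a / b * s + psi s)) @[s --> -oo] --> ln c.
      exact: (@continuous_cvg _ _ _ _ _ _ (@ln R) c (continuous_ln c0) h).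
    apply: cvg_trans h1; apply: near_eq_cvg; apply: nearW => s.
    by rewrite /= expRK.
  rewrite (_ : y = fun s => (1 - m) * (a / b * s + psi s)).
    by apply: cvgM => //; exact: cvg_cst.
  apply/funext => s; rewrite /y mulrDr addrC; congr (_ + _).
  by rewrite mulrA [_ * (a / b)]mulrA aG [b * G]mulrC mulfK// gt_eqF.
Unshelve. all: by end_near. Qed.

End SolutionToProfile.

(** * Uniform convergence on compact sets *)

Section UniformConvergence.
Variables (R : realType) (T : topologicalType) (K : set T).
Hypothesis Kc : compact K.

(** Joint convergence in the index and the point, at every point of a compact
    set and to a continuous limit, is uniform convergence on this set. *)
Lemma uniform_cvg_compact (F : set_system R) {FF : Filter F} (f : R -> T -> R)
    (f0 : T -> R) :
  (forall x, K x -> f p.1 p.2 @[p --> filter_prod F (nbhs x)] --> f0 x) ->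
  (forall x, K x -> {for x, continuous f0}) -> {uniform K, f @ F --> f0}.
Proof.
move=> fl f0c P; rewrite uniform_nbhs => -[E [entE EP]].
move: entE; rewrite -entourage_ballE => -[e /= e0 eE].
suff : \forall i \near F, K `<=` (fun x => ball (f0 x) e (f i x)).
  apply: (filterS (F := F)) => i h; apply: EP => x Kx; apply: eE; exact: h.
apply: (iffLR (compact_near_coveringP K) Kc) => x Kx.
have e2 : 0 < e / 2 by rewrite divr_gt0.
have [[A B] /= [FA FB] AB] : \forall p \near filter_prod F (nbhs x),
    `|f0 x - f p.1 p.2| < e / 2.
  by have /cvgrPdist_lt := fl x Kx; exact.
have h0 : \forall x' \near x, `|f0 x - f0 x'| < e / 2.
  by have /cvgrPdist_lt := f0c x Kx; exact.
exists (B `&` [set x' | `|f0 x - f0 x'| < e / 2], A) => /=.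
  by split => //; exact: filterI.
move=> [x' i] /= [[Bx' hx'] Ai]; rewrite /ball/=.
have {}hx' : `|f0 x - f0 x'| < e / 2 := hx'.
have h : `|f0 x - f i x'| < e / 2 := AB (i, x') (conj Ai Bx').
have := ler_distD (f0 x) (f0 x') (f i x'); rewrite (distrC (f0 x') (f0 x)); lra.
Qed.

End UniformConvergence.

(** * From profiles to radial functions *)

Section ProfileToSolution.
Variables (R : realType) (n : nat) (G b : R).
Implicit Types (x : 'rV[R]_n) (s m u p : R) (i j : 'I_n) (y q : R -> R).
Local Notation N := (n%:R - 2 : R).
Local Notation rhs := (profile_rhs N G b (G - 2)).

(** The radial function of exponent [m] with profile [y]. *)
Definition profile_fun m y x : R :=
  expR ((y (lognorm x) - G * lognorm x) / (1 - m)).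

(** The generatrix [V s = e^((y s - G s) / (1 - m))] and its first two
    derivatives, as functions of [m], [u = y s], [p = q s] and [s]; in the
    second one, the derivative of [q] is replaced by the right-hand side of the
    profile equation. *)
Definition value m u s : R := expR ((u - G * s) / (1 - m)).
Definition value1 m u p s : R := value m u s * ((p - G) / (1 - m)).
Definition value2 m u p s : R := value m u s *
  (rhs (m / (1 - m)) s u p / (1 - m) + ((p - G) / (1 - m)) ^+ 2).

(** The partial derivatives of first and second order of [profile_fun m y], as
    functions of [m], [u = y (ln |x|)], [p = q (ln |x|)] and [x]. *)
Definition gradient_formula i m u p x : R :=
  value1 m u p (lognorm x) * (x 0 i / sqnorm x).
Definition hessian_formula i j m u p x : R :=
  value2 m u p (lognorm x) * (x 0 i * x 0 j / sqnorm x ^+ 2) +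
  value1 m u p (lognorm x) *
    ((i == j)%:R / sqnorm x - 2 * (x 0 i * x 0 j) / sqnorm x ^+ 2).

Section OneProfile.
Variables (l m : R) (y q : R -> R) (v : 'rV[R]_n -> R).
Hypotheses (m1 : m != 1) (hp : profile N G b (G - 2) l (m / (1 - m)) y q)
  (vE : forall x, x != 0 -> v x = profile_fun m y x).

Let m1' : 1 - m != 0. Proof. by rewrite subr_eq0 eq_sym. Qed.

Let V s := value m (y s) s.
Let V1 s := value1 m (y s) (q s) s.
Let V2 s := value2 m (y s) (q s) s.

Let dV s : is_derive s 1 V (V1 s).
Proof.
case: hp => yd _ _.
have h := is_deriveZ (1 - m)^-1 (is_deriveB (yd s)
  (is_deriveZ G (is_derive_id s 1))).
have -> : V = (fun t => expR ((1 - m)^-1 * (y t - G * t))).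
  by apply/funext => t; rewrite /V /value mulrC.
apply: (is_derive_eq (is_derive_chain (is_derive_expR _) h)).
rewrite /V1 /value1 /value /GRing.scale/= mulr1.
by congr (expR _ * _); exact: mulrC.
Qed.

Let dV1 s : is_derive s 1 V1 (V2 s).
Proof.
case: hp => _ qd _.
have h := is_deriveZ (1 - m)^-1 (is_deriveB (qd s) (is_derive_cst G s 1)).
have h1 := is_deriveM (dV s) h.
have -> : V1 = V * (fun t => (1 - m)^-1 * (q t - G)).
  by apply/funext => t; rewrite /V1 /value1 mulrC [_ / _]mulrC mulrC.
apply: (is_derive_eq h1).
rewrite /V2 /value2 /V1 /value1 -/(V s) /GRing.scale/=.
by rewrite -[X in _ + X * _ = _]/((1 - m)^-1 * (q s - G)); field.
Qed.

Let vV x : x != 0 -> v x = V (lognorm x).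
Proof. exact: vE. Qed.

Lemma profile_partial i x : x != 0 -> partial i v x =
  gradient_formula i m (y (lognorm x)) (q (lognorm x)) x.
Proof. by move=> x0; rewrite (partial_radial vV dV). Qed.

Lemma profile_derivable i x : x != 0 -> derivable v x (delta_mx 0 i).
Proof. by move=> x0; have [] := is_derive_radial vV dV i x0. Qed.

Lemma profile_partial2 i j x : x != 0 -> partial j (partial i v) x =
  hessian_formula i j m (y (lognorm x)) (q (lognorm x)) x.
Proof. by move=> x0; rewrite (partial2_radial vV dV dV1). Qed.

Lemma profile_derivable2 i j x : x != 0 ->
  derivable (partial i v) x (delta_mx 0 j).
Proof. by move=> x0; have [] := is_derive_partial_radial vV dV dV1 i j x0. Qed.

Lemma profile_x_dot_grad x : x != 0 -> x_dot_grad v x = V1 (lognorm x).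
Proof. by move=> x0; rewrite (x_dot_grad_radial vV dV). Qed.

End OneProfile.

Lemma continuous_sqnorm x : {for x, continuous (@sqnorm R n)}.
Proof.
suff h : continuous (@sqnorm R n) by exact: h.
apply: continuous_big => [|i _ z]; first exact: add_continuous.
have h : w 0 i @[w --> z] --> z 0 i by exact: (@coord_continuous R 1 n 0 i z).
exact: (cvgM h h).
Qed.

Lemma continuous_lognorm x : x != 0 -> {for x, continuous (@lognorm R n)}.
Proof.
move=> x0.
have h : enorm z @[z --> x] --> enorm x.
  have hs : sqnorm z @[z --> x] --> sqnorm x by exact: continuous_sqnorm.
  exact: (@continuous_cvg _ _ _ _ _ _ (@Num.sqrt R) _ (@sqrt_continuous R _) hs).
exact: (@continuous_cvg _ _ _ _ _ _ (@ln R) _ (continuous_ln (enorm_gt0 x0)) h).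
Qed.

(* Continuity of these expressions, along an arbitrary filter. *)
Section Formulas.
Variables (T : Type) (F : set_system T).
Context {FF : Filter F}.
Variables (M U P : T -> R) (X : T -> 'rV[R]_n) (m u p : R) (x : 'rV[R]_n).
Hypotheses (m1 : m != 1) (x0 : x != 0).
Hypotheses (Ml : M t @[t --> F] --> m) (Ul : U t @[t --> F] --> u)
  (Pl : P t @[t --> F] --> p) (Xl : X t @[t --> F] --> x).

Let Sl : lognorm (X t) @[t --> F] --> lognorm x.
Proof. by apply: continuous_cvg Xl; exact: continuous_lognorm. Qed.

Let Il : (1 - M t)^-1 @[t --> F] --> (1 - m)^-1.
Proof.
apply: cvgV; first by rewrite subr_eq0 eq_sym.
by apply: cvgB => //; exact: cvg_cst.
Qed.

Lemma value_cvg : value (M t) (U t) (lognorm (X t)) @[t --> F] -->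
  value m u (lognorm x).
Proof.
apply: continuous_cvg; first exact: continuous_expR.
apply: cvgM => //; apply: cvgB => //.
by apply: cvgM => //; exact: cvg_cst.
Qed.

Let slope_cvg : (P t - G) / (1 - M t) @[t --> F] --> (p - G) / (1 - m).
Proof. by apply: cvgM => //; apply: cvgB => //; exact: cvg_cst. Qed.

Let value1_cvg : value1 (M t) (U t) (P t) (lognorm (X t)) @[t --> F] -->
  value1 m u p (lognorm x).
Proof. by apply: cvgM => //; exact: value_cvg. Qed.

Let value2_cvg : value2 (M t) (U t) (P t) (lognorm (X t)) @[t --> F] -->
  value2 m u p (lognorm x).
Proof.
apply: cvgM; first exact: value_cvg.
apply: cvgD; last by apply: cvgM.
apply: cvgM => //.
have h : G - P t @[t --> F] --> G - p by apply: cvgB => //; exact: cvg_cst.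
apply: cvgB.
  apply: cvgM => //; apply: cvgB; first exact: cvg_cst.
  by apply: cvgM => //; apply: cvgM.
apply: cvgM => //; apply: cvgM; first exact: cvg_cst.
apply: continuous_cvg; first exact: continuous_expR.
apply: cvgB => //.
by apply: cvgM => //; exact: cvg_cst.
Qed.

Let coord_cvg i : X t 0 i @[t --> F] --> x 0 i.
Proof. exact: (cvg_comp _ _ Xl (@coord_continuous R 1 n 0 i x)). Qed.

Let isq_cvg : (sqnorm (X t))^-1 @[t --> F] --> (sqnorm x)^-1.
Proof.
apply: cvgV; first by rewrite gt_eqF// sqnorm_gt0.
by apply: continuous_cvg Xl; exact: continuous_sqnorm.
Qed.

Let isq2_cvg : (sqnorm (X t) ^+ 2)^-1 @[t --> F] --> (sqnorm x ^+ 2)^-1.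
Proof.
apply: cvgV; first by rewrite gt_eqF// exprn_gt0// sqnorm_gt0.
have h : sqnorm (X t) @[t --> F] --> sqnorm x.
  by apply: continuous_cvg Xl; exact: continuous_sqnorm.
exact: cvgM.
Qed.

Lemma gradient_formula_cvg i :
  gradient_formula i (M t) (U t) (P t) (X t) @[t --> F] -->
  gradient_formula i m u p x.
Proof. by apply: cvgM => //; apply: cvgM. Qed.

Lemma hessian_formula_cvg i j :
  hessian_formula i j (M t) (U t) (P t) (X t) @[t --> F] -->
  hessian_formula i j m u p x.
Proof.
have h : X t 0 i * X t 0 j @[t --> F] --> x 0 i * x 0 j by exact: cvgM.
apply: cvgD; apply: cvgM => //; first exact: cvgM.
apply: cvgB; first by apply: cvgM => //; exact: cvg_cst.
by apply: cvgM => //; apply: cvgM => //; exact: cvg_cst.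
Qed.

End Formulas.

End ProfileToSolution.

(** * The logarithmic solution and the convergence to it *)

Section LimitSolution.
Variables (R : realType) (n : nat) (G b l : R).
Hypothesis b0 : 0 < b.
Implicit Types (x : 'rV[R]_n) (s m u p : R) (i j : 'I_n) (y q : R -> R).
Local Notation N := (n%:R - 2 : R).
Local Notation profile := (profile N G b (G - 2) l).

Lemma lognorm_cvgNy : @lognorm R n x @[x --> (0 : 'rV[R]_n)^'] --> -oo.
Proof.
have h : enorm x @[x --> (0 : 'rV[R]_n)] --> (0 : R).
  have hs : sqnorm x @[x --> (0 : 'rV[R]_n)] --> (0 : R).
    rewrite -[X in _ --> X](_ : sqnorm (0 : 'rV[R]_n) = 0).
      exact: continuous_sqnorm.
    by rewrite /sqnorm big1// => i _; rewrite mxE expr0n.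
  rewrite -(sqrtr0 R).
  exact: (@continuous_cvg _ _ _ _ _ _ (@Num.sqrt R) _ (@sqrt_continuous R _) hs).
apply: (@cvg_comp _ _ _ (@enorm R n) (@ln R) _ (0 : R)^'+); last exact: lnNy.
move=> A /h hA.
have {}hA : \forall x \near (0 : 'rV[R]_n), 0 < enorm x -> A (enorm x) := hA.
suff : \forall x \near (0 : 'rV[R]_n), x != 0 -> A (enorm x) by [].
by apply: filterS hA => x hx x0; apply: hx; exact: enorm_gt0.
Qed.

Section LogSolution.
Variables (y q : R -> R).
Hypothesis hp : profile 0 y q.
Let v : 'rV[R]_n -> R := profile_fun G 0 y.

Let zero_neq1 : (0 : R) != 1. Proof. by rewrite eq_sym oner_eq0. Qed.
Let hp0 : profile (0 / (1 - 0)) y q. Proof. by rewrite mul0r; exact: hp. Qed.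
Let vE x : x != 0 -> v x = profile_fun G 0 y x. Proof. by []. Qed.

Let yc x : x != 0 -> y (lognorm z) @[z --> x] --> y (lognorm x).
Proof.
move=> x0; case: hp => yd _ _.
apply: (cvg_comp _ _ (continuous_lognorm x0)).
exact: (is_derive_continuous yd).
Qed.

Let qc x : x != 0 -> q (lognorm z) @[z --> x] --> q (lognorm x).
Proof.
move=> x0; case: hp => _ qd _.
apply: (cvg_comp _ _ (continuous_lognorm x0)).
exact: (is_derive_continuous qd).
Qed.

Let mc x : (fun=> 0 : R) z @[z --> x] --> (0 : R).
Proof. exact: (@cvg_cst _ _ _ (nbhs x)). Qed.

Lemma profile_fun_continuous x : x != 0 -> {for x, continuous v}.
Proof. by move=> x0; apply: (value_cvg zero_neq1 x0 (@mc x) (yc x0) cvg_id). Qed.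

Lemma profile_partial_continuous i x : x != 0 ->
  {for x, continuous (partial i v)}.
Proof.
move=> x0; suff : partial i v z @[z --> x] --> partial i v x by [].
rewrite (profile_partial hp0 vE i x0).
have h : gradient_formula G i 0 (y (lognorm z)) (q (lognorm z)) z @[z --> x] -->
    gradient_formula G i 0 (y (lognorm x)) (q (lognorm x)) x.
  exact: (gradient_formula_cvg zero_neq1 x0 (@mc x) (yc x0) (qc x0) cvg_id).
have E : \forall z \near x,
    gradient_formula G i 0 (y (lognorm z)) (q (lognorm z)) z = partial i v z.
  near=> z; rewrite (profile_partial hp0 vE)//.
  by near: z; exact: near_neq0.
exact: (cvg_trans (near_eq_cvg E) h).
Unshelve. all: by end_near. Qed.

Lemma profile_partial2_continuous i j x : x != 0 ->
  {for x, continuous (partial j (partial i v))}.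
Proof.
move=> x0.
suff : partial j (partial i v) z @[z --> x] --> partial j (partial i v) x by [].
rewrite (profile_partial2 zero_neq1 hp0 vE i j x0).
have h :
  hessian_formula G b i j 0 (y (lognorm z)) (q (lognorm z)) z @[z --> x] -->
    hessian_formula G b i j 0 (y (lognorm x)) (q (lognorm x)) x.
  exact: (hessian_formula_cvg zero_neq1 x0 (@mc x) (yc x0) (qc x0) cvg_id).
have E : \forall z \near x,
    hessian_formula G b i j 0 (y (lognorm z)) (q (lognorm z)) z =
    partial j (partial i v) z.
  near=> z; rewrite (profile_partial2 zero_neq1 hp0 vE)//.
  by near: z; exact: near_neq0.
exact: (cvg_trans (near_eq_cvg E) h).
Unshelve. all: by end_near. Qed.

(** A profile of parameter [0] defines a radial solution of the logarithmic
    equation with the prescribed behaviour at the origin. *)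
Lemma log_solution : radial_solution_with_limit (@ln R) (b * G) b (expR l) v.
Proof.
split; first split.
- move=> x x0; split; first exact: profile_fun_continuous.
  move=> i; split; first exact: (profile_derivable hp0 vE).
    exact: profile_partial_continuous.
  move=> j; split; first exact: (profile_derivable2 zero_neq1 hp0 vE).
  exact: profile_partial2_continuous.
- by move=> x _; exact: expR_gt0.
- move=> x x0; rewrite (profile_x_dot_grad hp0 vE)//.
  case: (hp) => yd qd _.
  have lnE z : z != 0 -> (@ln R \o v) z = y (lognorm z) - G * lognorm z.
    by move=> _; rewrite /= expRK subr0 divr1.
  have d1 s : is_derive s 1 (fun t => y t - G * t) (q s - G).
    have h := is_deriveB (yd s) (is_deriveZ G (is_derive_id s 1)).
    by apply: (is_derive_eq h); rewrite /GRing.scale/= mulr1.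
  have d2 s : is_derive s 1 (fun t => q t - G)
      (profile_rhs N G b (G - 2) 0 s (y s) (q s)).
    apply: (is_derive_eq (is_deriveB (qd s) (is_derive_cst G s 1))).
    by rewrite subr0.
  rewrite (laplacian_radial lnE d1 d2)// -expR_2lognorm//.
  rewrite /v /profile_fun /value1 /value /profile_rhs !subr0 !divr1 mul0r.
  set s := lognorm x.
  have -> : y s - (G - 2) * s = (y s - G * s) + 2 * s by ring.
  rewrite expRD; field.
  by rewrite gt_eqF ?expR_gt0.
- move=> x z x0 z0 xz; rewrite /v /profile_fun.
  by rewrite (_ : lognorm x = lognorm z)// /lognorm xz.
- have h : expR (y (lognorm x)) @[x --> (0 : 'rV[R]_n)^'] --> expR l.
    case: hp => _ _ yl; apply: (@continuous_cvg _ _ _ _ _ _ (@expR R)).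
      exact: continuous_expR.
    exact: (cvg_comp _ _ lognorm_cvgNy yl).
  apply: cvg_trans h; apply: near_eq_cvg; near=> x.
  have x0 : x != 0 by near: x; exact: nbhs_dnbhs_neq.
  rewrite /v /profile_fun -expR_lognorm// -expRM -expRD subr0 divr1.
  congr expR; field.
  by rewrite gt_eqF.
Unshelve. all: by end_near. Qed.

End LogSolution.

Section Convergence.
Variables (F : set_system R).
Context {PF : ProperFilter F}.
Variables (vm : R -> 'rV[R]_n -> R) (y q : R -> R -> R) (y0 q0 : R -> R).
Hypotheses (F0 : m @[m --> F] --> (0 : R))
  (ym : \forall m \near F, profile (m / (1 - m)) (y m) (q m) /\
     forall x, x != 0 -> vm m x = profile_fun G m (y m) x)
  (hp : profile 0 y0 q0)
  (yl : forall s, y p.1 p.2 @[p --> filter_prod F (nbhs s)] --> y0 s)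
  (ql : forall s, q p.1 p.2 @[p --> filter_prod F (nbhs s)] --> q0 s).

Let zero_neq1 : (0 : R) != 1. Proof. by rewrite eq_sym oner_eq0. Qed.
Let hp0 : profile (0 / (1 - 0)) y0 q0. Proof. by rewrite mul0r; exact: hp. Qed.
Let v : 'rV[R]_n -> R := profile_fun G 0 y0.
Let vE x : x != 0 -> v x = profile_fun G 0 y0 x. Proof. by []. Qed.

Let near_good x : x != 0 -> \forall p \near filter_prod F (nbhs x),
  [/\ p.1 != 1, p.2 != 0, profile (p.1 / (1 - p.1)) (y p.1) (q p.1) &
    forall z, z != 0 -> vm p.1 z = profile_fun G p.1 (y p.1) z].
Proof.
move=> x0.
have m1 : \forall m \near F, m != 1.
  have : \forall m \near F, m < 1 by apply: (cvgr_lt _ F0); exact: ltr01.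
  by apply: filterS => m; move/lt_eqF ->.
have h := filterI m1 ym.
exists ([set m | m != 1] `&` [set m | profile (m / (1 - m)) (y m) (q m) /\
     forall x, x != 0 -> vm m x = profile_fun G m (y m) x], [set z | z != 0]).
  by split; [exact: h|exact: near_neq0].
by move=> [m z] [[? []]].
Qed.

Let comp_cvg (f : R -> R -> R) x (c : R) : x != 0 ->
  f p.1 p.2 @[p --> filter_prod F (nbhs (lognorm x))] --> c ->
  f p.1 (lognorm p.2) @[p --> filter_prod F (nbhs x)] --> c.
Proof.
move=> x0 fc.
have h1 : p.1 @[p --> filter_prod F (nbhs x)] --> F by exact: cvg_fst.
have h2 : lognorm p.2 @[p --> filter_prod F (nbhs x)] --> lognorm x.
  apply: (@cvg_comp _ _ _ snd (@lognorm R n) _ (nbhs x)); first exact: cvg_snd.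
  exact: continuous_lognorm.
exact: (cvg_comp _ _ (cvg_pair h1 h2) fc).
Qed.

Let Ml x : p.1 @[p --> filter_prod F (nbhs x)] --> (0 : R).
Proof. by apply: cvg_comp F0; exact: cvg_fst. Qed.

Let Xl x : p.2 @[p --> filter_prod F (nbhs x)] --> x.
Proof. exact: cvg_snd. Qed.

(** If the profiles and their slopes converge jointly, the radial functions
    converge in [C^2] uniformly on compact sets off the origin. *)
Lemma cvg_C2 (K : set 'rV[R]_n) : compact K -> K `<=` [set x | x != 0] ->
  cvg_uniform_C2 K F vm v.
Proof.
move=> Kc K0; split.
- apply: uniform_cvg_compact => // x /K0 /= x0; last first.
    exact: (profile_fun_continuous hp).
  apply: cvg_trans (value_cvg zero_neq1 x0 (@Ml x) (comp_cvg x0 (@yl _)) (@Xl x)).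
  apply: near_eq_cvg; have := near_good x0.
  apply: filterS => -[m z] /= [_ z0 _ h].
  by rewrite h.
- move=> i; apply: uniform_cvg_compact => // x /K0 /= x0; last first.
    exact: (profile_partial_continuous hp).
  rewrite (profile_partial hp0 vE)//.
  apply: cvg_trans (gradient_formula_cvg (i := i) zero_neq1 x0 (@Ml x)
    (comp_cvg x0 (@yl _)) (comp_cvg x0 (@ql _)) (@Xl x)).
  apply: near_eq_cvg; have := near_good x0.
  apply: filterS => -[m z] /= [m1 z0 pm h].
  by rewrite (profile_partial pm h).
- move=> i j; apply: uniform_cvg_compact => // x /K0 /= x0; last first.
    exact: (profile_partial2_continuous hp).
  rewrite (profile_partial2 zero_neq1 hp0 vE)//.
  apply: cvg_trans (hessian_formula_cvg (b := b) (i := i) (j := j)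
    zero_neq1 x0 (@Ml x)
    (comp_cvg x0 (@yl _)) (comp_cvg x0 (@ql _)) (@Xl x)).
  apply: near_eq_cvg; have := near_good x0.
  apply: filterS => -[m z] /= [m1 z0 pm h].
  by rewrite (profile_partial2 m1 pm h).
Qed.

End Convergence.

End LimitSolution.

Theorem theorem1p5 (R : realType) (n : nat) (rho1 lambda beta alpha mbar0 : R)
    (vm : R -> 'rV[R]_n -> R) :
  (3 <= n)%N -> 0 < rho1 -> 0 < lambda -> 0 < beta ->
  alpha = 2 * beta + rho1 ->
  0 < mbar0 < (n%:R - 2) / n%:R ->
  beta0 n rho1 mbar0 <= beta ->
  (forall m : R, 0 < m < mbar0 ->
    radial_solution_with_limit (fun s => s `^ m / m)
      (alpha_ rho1 beta m) beta
      (lambda `^ (- (rho1 / ((1 - m) * beta)))) (vm m)) ->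
  exists v : 'rV[R]_n -> R,
    unique_radial_solution_with_limit (@ln R) alpha beta
      (lambda `^ (- (rho1 / beta))) v /\
    forall K : set 'rV[R]_n, compact K -> K `<=` [set x | x != 0] ->
      cvg_uniform_C2 K 0^'+ vm v.
Proof.
move=> n3 rho0 lam0 beta_gt0 -> /andP[mbar_gt0 _] _ hvm.
have n_gt0 : (0 < n)%N by apply: leq_trans n3.
pose N : R := n%:R - 2; pose G : R := 2 + rho1 / beta.
pose l : R := - (rho1 / beta) * ln lambda.
have k0 : 0 < rho1 / beta by rewrite divr_gt0.
have N0 : 0 < N by rewrite subr_gt0 ltr_nat.
have G0 : 0 < G by rewrite addr_gt0.
have G2 : 0 < G - 2 by rewrite /G addrAC subrr add0r.
have bG : 2 * beta + rho1 = beta * G by rewrite /G; field; rewrite gt_eqF.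
have expl : expR l = lambda `^ (- (rho1 / beta)).
  by rewrite /powR gt_eqF.
have m_cvg : m @[m --> 0^'+] --> (0 : R).
  by apply: (@cvg_at_right_filter _ _ id); exact: cvg_id.
have mu_cvg : m / (1 - m) @[m --> 0^'+] --> (0 : R).
  rewrite -[X in _ --> X](mul0r (1 - 0)^-1); apply: cvgM => //.
  apply: cvgV; first by rewrite subr0 oner_eq0.
  by apply: cvgB => //; exact: cvg_cst.
have near_m : \forall m \near (0 : R)^'+, [/\ 0 < m, m < mbar0 & m < 1].
  near=> m; split; near: m; [exact: nbhs_right_gt|exact: nbhs_right_lt|].
  by apply: nbhs_right_lt; exact: ltr01.
have mu_small : \forall m \near (0 : R)^'+, small_exponent N G (m / (1 - m)).
  have h : \forall m \near (0 : R)^'+, m / (1 - m) < N / (2 * G).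
    by apply: (cvgr_lt _ mu_cvg); rewrite divr_gt0// mulr_gt0.
  apply: filterS2 near_m h => m [m0 _ m1].
  rewrite ltr_pdivlMr ?mulr_gt0// => h; split; last by lra.
  by rewrite divr_ge0 ?subr_ge0 ?ltW.
pose P (m : R) (yq : (R -> R) * (R -> R)) : Prop := 0 < m < mbar0 -> m < 1 ->
  profile N G beta (G - 2) l (m / (1 - m)) yq.1 yq.2 /\
  forall x, x != 0 -> vm m x = profile_fun G m yq.1 x.
(* A choice of a profile and of its slope for every exponent. *)
have [|yq hyq] := @boolp.choice _ _ P.
  move=> m; rewrite /P.
  have [/andP[m0 mb]|] := boolP (0 < m < mbar0); last by exists (id, id).
  have [m1|] := ltP m 1; last by exists (id, id).
  have m1' : 1 - m != 0 by rewrite gt_eqF ?subr_gt0.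
  have mm : 0 <= m < 1 by rewrite ltW.
  have c0 : 0 < lambda `^ (- (rho1 / ((1 - m) * beta))) by exact: powR_gt0.
  have aG : (1 - m) * alpha_ rho1 beta m = beta * G.
    by rewrite -bG /alpha_ mulrC divfK.
  have dphi (u : R) : is_derive u 1 (fun t => expR t `^ m / m) (expR (m * u)).
    have -> : (fun t : R => expR t `^ m / m) = (fun t => m^-1 * expR (m * t)).
      by apply/funext => t; rewrite -expRM mulrC [t * _]mulrC.
    apply: (is_derive_eq (is_deriveZ m^-1 (is_derive_expRk m u))).
    by rewrite /GRing.scale/= mulKf// gt_eqF.
  have [|y [q [hp hv]]] := solution_profile n_gt0 mm beta_gt0 c0 aG dphi
    (hvm m _).
    by rewrite m0.
  exists (y, q) => _ _; split => //.
  rewrite /l; move: hp; rewrite ln_powR.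
  suff -> : (1 - m) * (- (rho1 / ((1 - m) * beta)) * ln lambda) =
    - (rho1 / beta) * ln lambda by [].
  by field; rewrite m1' gt_eqF.
have near_yq : \forall m \near (0 : R)^'+,
    profile N G beta (G - 2) l (m / (1 - m)) (yq m).1 (yq m).2 /\
    forall x, x != 0 -> vm m x = profile_fun G m (yq m).1 x.
  by apply: filterS near_m => m [m0 mb m1]; apply: hyq; rewrite ?m0.
have near_profile : \forall m \near (0 : R)^'+,
    profile N G beta (G - 2) l (m / (1 - m)) (yq m).1 (yq m).2.
  by apply: filterS near_yq => m [].
have [y0 [q0 [hp yl ql]]] :=
  profile_limit N0 G0 beta_gt0 G2 mu_cvg mu_small near_profile.
exists (profile_fun G 0 y0); split; last first.
  move=> K Kc K0.
  exact: (cvg_C2 m_cvg near_yq hp yl ql Kc K0).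
split; first by rewrite bG -expl; exact: (log_solution beta_gt0 hp).
move=> w; rewrite bG -expl => hw x x0.
have dphi (u : R) : is_derive u 1 (fun t => ln (expR t)) (expR (0 * u)).
  rewrite mul0r expR0 (_ : (fun t : R => ln (expR t)) = id).
    exact: is_derive_id.
  by apply/funext => t; rewrite expRK.
have m01 : 0 <= (0 : R) < 1 by rewrite lexx ltr01.
have aG : (1 - 0) * (beta * G) = beta * G by rewrite subr0 mul1r.
have [y [q [hq hw']]] :=
  solution_profile n_gt0 m01 beta_gt0 (expR_gt0 l) aG dphi hw.
rewrite subr0 mul1r mul0r expRK in hq.
rewrite hw'// /profile_fun.
by rewrite (profile_unique N0 G0 beta_gt0 G2 hq hp).
Unshelve. all: by end_near. Qed.
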